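(* Let $\Omega=\{0,1\}^{\mathbb N}$ with the one-sided shift $\sigma:\Omega\to\Omega$. If $\mathbf a=(a_n)_{n\in\mathbb N}$ is an evanescent sequence, then the set $\mathsf L_{\mathbf a}$ of functions in $C^{\mathbf a}(\Omega)$ with the locking property is a prevalent set in the Banach space $C^{\mathbf a}(\Omega)$.
   Context: $\mathbb N$ includes $0$. $\sigma$ is the left shift on $\Omega=\{0,1\}^{\mathbb N}$ (product topology), and $\mathcal M_\sigma$ is the set of $\sigma$-invariant Borel probability measures on $\Omega$. A measure in $\mathcal M_\sigma$ is periodic if it is supported on a periodic orbit. Metric and function space. Let $\mathbf a=(a_n)_{n\in\mathbb N}$ be a strictly decreasing sequence of positive numbers converging to $0$ (written $\mathbf a\searrow 0$). Define $d_{\mathbf a}(x,y)=a_m$, where $m$ is the least index with $x_m\ne y_m$, and $d_{\mathbf a}(x,x)=0$. $C^{\mathbf a}(\Omega)$ is the space of functions $f:\Omega\to\mathbb R$ that are Lipschitz with respect to $d_{\mathbf a}$, with norm $\|f\|_\infty+\operatorname{Lip}_{\mathbf a}(f)$, where $\operatorname{Lip}_{\mathbf a}(f)$ is the least Lipschitz constant with respect to $d_{\mathbf a}$. It is a (non-separable) Banach space. Evanescent: $\mathbf a\searrow 0$ and $a_{n+1}/a_n=O(2^{-2^{n+2}})$ as $n\to\infty$. Maximizing measure: $\mu\in\mathcal M_\sigma$ is maximizing for a continuous $f$ if $\int f\,d\mu=\sup_{\nu\in\mathcal M_\sigma}\int f\,d\nu$. Locking property: $f\in C^{\mathbf a}(\Omega)$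 has the locking property if it has a unique maximizing measure $\mu$, $\mu$ is periodic, and $\mu$ is the unique maximizing measure of every $\tilde f\in C^{\mathbf a}(\Omega)$ sufficiently close to $f$ in the norm of $C^{\mathbf a}(\Omega)$. $\mathsf L_{\mathbf a}\subset C^{\mathbf a}(\Omega)$ is the set of functions with the locking property. Prevalence: let $V$ be a completely metrizable vector space. A Borel set $S\subset V$ is shy if there is a compactly supported Borel probability measure $m$ on $V$ with $m(S+v)=0$ for every $v\in V$. A subset of $V$ is prevalent if its complement is contained in a shy set. *)

(* Defs.v *)
From HB Require Import structures.
From mathcomp Require Import all_boot all_order all_algebra.
From mathcomp Require Import all_classical all_reals all_analysis.
From mathcomp Require Import lra.

Set Implicit Arguments.
Unset Strict Implicit.
Unset Printing Implicit Defensive.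

Import Order.TTheory GRing.Theory Num.Theory.
Import numFieldNormedType.Exports.

Local Open Scope classical_set_scope.
Local Open Scope ring_scope.

(* Bundled, because the Lipschitz space below is normed only under hypotheses
   on the sequence: boundedness and positivity of its terms. *)
Record null_seq (R : realType) := NullSeq {
  null_seq_fun :> nat -> R ;
  null_seq_gt0 : forall n, 0 < null_seq_fun n ;
  null_seq_decreasing : decreasing_seq null_seq_fun ;
  null_seq_cvg0 : null_seq_fun n @[n --> \oo] --> 0 }.

Definition evanescent (R : realType) (a : null_seq R) : Prop :=
  (fun n : nat => a n.+1 / a n : R) =O_\oo (fun n : nat => 2 ^- (2 ^ n.+2)%N : R).

Definition seq_dist (R : realType) (a : null_seq R) (x y : cantor_space) : R :=
  match pselect (exists n, x n != y n) with
  | left h => a (ex_minn h)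
  | right _ => 0
  end.

Definition lip_const (R : realType) (a : null_seq R) (f : cantor_space -> R)
    (L : R) : Prop :=
  forall x y, `|f x - f y| <= L * seq_dist a x y.

Section seq_dist_theory.
Context (R : realType) (a : null_seq R).
Implicit Types (x y : cantor_space) (f g : cantor_space -> R).

Lemma null_seq_le0 n : a n <= a 0%N.
Proof. by rewrite (null_seq_decreasing a). Qed.

Lemma seq_dist_ge0 x y : 0 <= seq_dist a x y.
Proof. by rewrite /seq_dist; case: pselect => // h; exact/ltW/null_seq_gt0. Qed.

Lemma seq_dist_le x y : seq_dist a x y <= a 0%N.
Proof.
rewrite /seq_dist; case: pselect => [h|_]; first exact: null_seq_le0.
exact/ltW/null_seq_gt0.
Qed.

Lemma seq_distxx x : seq_dist a x x = 0.
Proof. by rewrite /seq_dist; case: pselect => // h; have [n /eqP] := h. Qed.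

Lemma seq_dist_gt0 x y : x <> y -> 0 < seq_dist a x y.
Proof.
move=> xy; rewrite /seq_dist; case: pselect => [h|nh]; first exact: null_seq_gt0.
exfalso; apply: xy; apply/funext => n; apply/eqP; apply: contrapT => /negP xyn.
by apply: nh; exists n.
Qed.

Lemma lip_const_ge0 f L : lip_const a f L -> 0 <= L.
Proof.
move=> /(_ (fun=> true) (fun=> false)) fL.
have d0 : 0 < seq_dist a (fun=> true) (fun=> false).
  by apply: seq_dist_gt0 => /(congr1 (fun s => s 0%N)).
by rewrite -(pmulr_lge0 _ d0); apply: le_trans fL.
Qed.

Lemma lip_constS f L M : L <= M -> lip_const a f L -> lip_const a f M.
Proof.
move=> LM fL x y; apply: (le_trans (fL x y)).
by rewrite ler_wpM2r// seq_dist_ge0.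
Qed.

Lemma lip_const0 : lip_const a 0 0.
Proof. by move=> x y; rewrite subrr normr0 mul0r. Qed.

Lemma lip_constD f g L M : lip_const a f L -> lip_const a g M ->
  lip_const a (f + g) (L + M).
Proof.
move=> fL gM x y; rewrite mulrDl !fctE opprD addrACA.
by rewrite (le_trans (ler_normD _ _))// lerD.
Qed.

Lemma lip_constZ k f L : lip_const a f L -> lip_const a (k *: f) (`|k| * L).
Proof.
move=> fL x y; rewrite !fctE.
have -> : k *: f x - k *: f y = k * (f x - f y) by rewrite mulrBr.
by rewrite normrM -mulrA ler_wpM2l.
Qed.

End seq_dist_theory.

Section lipfun.
Context (R : realType) (a : null_seq R).

Definition is_lip : {pred cantor_space -> R} :=
  [pred f | `[< exists L, lip_const a f L >]].

Record lipfun := LipFun {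
  lipfun_val :> cantor_space -> R ;
  lipfunP : lipfun_val \in is_lip }.

HB.instance Definition _ := [isSub for lipfun_val].
HB.instance Definition _ := [Choice of lipfun by <:].

Lemma is_lip_submod_closed : submod_closed is_lip.
Proof.
split; first by apply/asboolP; exists 0; exact: lip_const0.
move=> k f g /asboolP[L fL] /asboolP[M gM]; apply/asboolP.
by exists (`|k| * L + M); apply: lip_constD => //; exact: lip_constZ.
Qed.

HB.instance Definition _ :=
  GRing.isSubmodClosed.Build _ _ is_lip is_lip_submod_closed.
HB.instance Definition _ := [SubChoice_isSubLmodule of lipfun by <:].

Definition sup_norm (f : cantor_space -> R) : R := sup (range (fun x => `|f x|)).
Definition lip (f : cantor_space -> R) : R := inf [set L | lip_const a f L].

Lemma lipfun_lip_const (f : lipfun) : exists L, lip_const a f L.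
Proof. exact/asboolP/(lipfunP f). Qed.

Lemma has_sup_lipfun (f : lipfun) : has_sup (range (fun x => `|f x|)).
Proof.
have [L fL] := lipfun_lip_const f.
split; first by exists (`|f (fun=> true)|), (fun=> true).
exists (`|f (fun=> true)| + L * a 0%N) => _ [x _ <-].
rewrite -(subrKC (f (fun=> true)) (f x)).
rewrite (le_trans (ler_normD _ _))// lerD2l// (le_trans (fL _ _))//.
by rewrite ler_wpM2l ?seq_dist_le// (lip_const_ge0 fL).
Qed.

Lemma ler_sup_norm (f : lipfun) x : `|f x| <= sup_norm f.
Proof. by apply: ub_le_sup; [case: (has_sup_lipfun f)|exists x]. Qed.

Lemma sup_norm_le f M : (forall x, `|f x| <= M) -> sup_norm f <= M.
Proof.
move=> fM; apply: ge_sup; first by exists (`|f (fun=> true)|), (fun=> true).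
by move=> _ [x _ <-].
Qed.

Lemma lip_const_lip (f : lipfun) : lip_const a f (lip f).
Proof.
move=> x y; have [->|/eqP xy] := eqVneq x y.
  by rewrite subrr normr0 seq_distxx mulr0.
have d0 := seq_dist_gt0 a xy.
rewrite -ler_pdivrMr//; apply: lb_le_inf; first exact: lipfun_lip_const.
by move=> L fL; rewrite ler_pdivrMr.
Qed.

Lemma lip_le f M : lip_const a f M -> lip f <= M.
Proof.
by move=> fM; apply: ge_inf => //; exists 0 => L /= /lip_const_ge0.
Qed.

Definition lip_norm (f : lipfun) : R := sup_norm f + lip f.

Lemma lip_normD f g : lip_norm (f + g) <= lip_norm f + lip_norm g.
Proof.
rewrite /lip_norm addrACA lerD//.
  apply: sup_norm_le => x; rewrite (le_trans (ler_normD _ _))// lerD//;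
    exact: ler_sup_norm.
by apply: lip_le; apply: lip_constD; exact: lip_const_lip.
Qed.

Let lip_normZ_le k f : lip_norm (k *: f) <= `|k| * lip_norm f.
Proof.
rewrite /lip_norm mulrDr lerD//.
  apply: sup_norm_le => x.
  have -> : (k *: f : lipfun) x = k * f x by [].
  by rewrite normrM ler_wpM2l// ler_sup_norm.
by apply: lip_le; apply: lip_constZ; exact: lip_const_lip.
Qed.

Lemma lip_norm_ge0 f : 0 <= lip_norm f.
Proof.
rewrite addr_ge0//; last exact: lip_const_ge0 (lip_const_lip f).
exact: le_trans (ler_sup_norm f (fun=> true)).
Qed.

Lemma lip_normZ k f : lip_norm (k *: f) = `|k| * lip_norm f.
Proof.
apply/eqP; rewrite eq_le lip_normZ_le/=.
have [->|k0] := eqVneq k 0; first by rewrite normr0 mul0r lip_norm_ge0.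
rewrite -ler_pdivlMl ?normr_gt0// -normfV.
by rewrite -{1}(scalerK k0 f) lip_normZ_le.
Qed.

Lemma lip_norm_eq0 f : lip_norm f = 0 -> f = 0.
Proof.
move=> f0; apply/val_inj/funext => x /=; apply/eqP; rewrite -normr_le0.
rewrite (le_trans (ler_sup_norm _ _))// -f0 lerDl.
exact: lip_const_ge0 (lip_const_lip f).
Qed.

HB.instance Definition _ :=
  Lmodule_isNormed.Build R lipfun lip_normD lip_normZ lip_norm_eq0.

Lemma lipfun_normE (f : lipfun) : `|f| = sup_norm f + lip f.
Proof. by []. Qed.

Lemma lipfun_complete (F : set_system lipfun) :
  ProperFilter F -> cauchy F -> cvg F.
Proof.
move=> FF /cauchyP Fc.
have evalB (f h : lipfun) x : `|f x - h x| <= `|f - h|.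
  apply: (le_trans (ler_sup_norm (f - h) x)).
  by rewrite lipfun_normE lerDl (lip_const_ge0 (lip_const_lip _)).
have Fx x : cvg ((f : lipfun) x @[f --> F]).
  apply: R_complete; apply/cauchyP => e e0.
  have [h Fh] := Fc e e0; exists (h x).
  suff : F [set f : lipfun | ball (h x) e (f x)] by [].
  apply: filterS Fh => f hf; rewrite -ball_normE/=.
  by apply: le_lt_trans (evalB h f x) _; rewrite -ball_normE in hf.
pose g x : R := lim ((f : lipfun) x @[f --> F]).
have gP h e : F (ball h e) ->
    (forall x, `|h x - g x| <= e) /\ lip_const a (h \- g) e.
  move=> Fh; split=> [x|x y].
    have cv : `|h x - (f : lipfun) x| @[f --> F] --> `|h x - g x|.
      by apply: cvg_norm; apply: cvgB; [exact: cvg_cst|exact: Fx].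
    apply: (closed_cvg (fun r : R => r <= e) _ _ _ cv).
      exact: closed_le.
    by apply: filterS Fh => f hf; apply: le_trans (ltW hf); exact: evalB.
  have cv : `|(h x - (f : lipfun) x) - (h y - f y)| @[f --> F] -->
      `|(h \- g) x - (h \- g) y|.
    apply: cvg_norm; apply: cvgB; apply: cvgB;
      [exact: cvg_cst|exact: Fx|exact: cvg_cst|exact: Fx].
  apply: (closed_cvg (fun r : R => r <= e * seq_dist a x y) _ _ _ cv).
    exact: closed_le.
  apply: filterS Fh => f hf; apply: (lip_constS _ (lip_const_lip (h - f))).
  apply: le_trans (ltW hf).
  by rewrite lipfun_normE lerDr (le_trans _ (ler_sup_norm _ (fun=> true))).
have g_lip : g \in is_lip.
  have [h /gP[_ hg]] := Fc 1 ltr01.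
  have -> : g = (-1) *: (h \- g) + h :> (cantor_space -> R).
    by apply/funext => x; rewrite !fctE scaleN1r opprB subrK.
  by apply: is_lip_submod_closed.2; [apply/asboolP; exists 1|exact: lipfunP].
apply/cvg_ex; exists (LipFun g_lip); apply/cvgrPdist_le => e e0.
have e3 : 0 < e / 3 by rewrite divr_gt0.
have [h Fh] := Fc _ e3; have [hg1 hg2] := gP _ _ Fh.
have hg : `|h - LipFun g_lip| <= e / 3 + e / 3.
  by rewrite lipfun_normE lerD//; [exact: sup_norm_le|exact: lip_le].
apply: filterS Fh => f hf.
rewrite -(subrK h (LipFun g_lip)) -addrA (le_trans (ler_normD _ _))//.
have -> : e = e / 3 + e / 3 + e / 3 by lra.
by rewrite lerD//; [rewrite distrC|exact: ltW].
Qed.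

HB.instance Definition _ := Uniform_isComplete.Build lipfun lipfun_complete.

End lipfun.

Notation borel T := (g_sigma_algebraType (@open T)).

Section prevalence.
Context (R : realType) (V : completeNormedModType R).

(* In a Hausdorff space compact sets are closed, so that m (~` K) is the
   measure of a Borel set. *)
Definition shy (S : set (borel V)) : Prop :=
  measurable S /\
  exists (m : probability (borel V) R) (K : set V),
    [/\ compact K, m (~` K) = 0%E &
        forall v : V, m [set (s : V) + v | s in S] = 0%E].

Definition prevalent (A : set V) : Prop :=
  exists S : set (borel V), shy S /\ ~` A `<=` S.

End prevalence.

Definition shift (x : cantor_space) : cantor_space := fun n => x n.+1.

Section ergodic_optimization.
Context (R : realType).
Implicit Types (mu nu : probability (borel cantor_space) R)
  (f : cantor_space -> R).

Definition invariant mu : Prop :=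
  forall A : set (borel cantor_space), measurable A -> mu (shift @^-1` A) = mu A.

Definition periodic_measure mu : Prop :=
  invariant mu /\ exists (x : cantor_space) (p : nat),
    [/\ (0 < p)%N, iter p shift x = x &
        mu (~` [set iter k shift x | k in [set: nat]]) = 0%E].

Definition maximizing mu f : Prop :=
  invariant mu /\
  (\int[mu]_x (f x)%:E =
   ereal_sup [set \int[nu]_x (f x)%:E | nu in [set nu | invariant nu]])%E.

(* The value of a measure is meaningful on measurable sets only, hence the
   restriction in the uniqueness clause. *)
Definition unique_maximizing mu f : Prop :=
  maximizing mu f /\
  forall nu, maximizing nu f ->
    forall A : set (borel cantor_space), measurable A -> nu A = mu A.

Definition locking (a : null_seq R) : set (lipfun a) :=
  [set f : lipfun a | exists mu : probability (borel cantor_space) R,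
     [/\ unique_maximizing mu f, periodic_measure mu &
         \forall g \near nbhs f, unique_maximizing mu (g : lipfun a)]].

End ergodic_optimization.

Arguments locking {R} a.

(* Main.v *)
(* The probe is a line: for a well-chosen phi and every v, the function t phi - v
   has the locking property for almost every t in [0, 1].

   Replace f by a function F of the first n + 1 letters, at uniform distance
   O(a_(n+1)).  A word-step graph with 2^n vertices carries F as an edge weight,
   and an invariant measure is controlled by means of F over simple cycles.  If
   one simple cycle beats all others by a gap larger than a constant times
   a_(n+1), cutting orbits into simple cycles shows that its periodic measure
   uniquely maximizes f, and also every perturbation of f.

   There are N <= 2^n 2^(2^n) simple cycles.  At level n, phi gets weights of
   size about a_n, chosen by counting so that the means of phi over distinct
   cycles are at distance at least about a_n / N^2.  For a fixed cycle E, the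
   parameters t at which E is optimal but another cycle comes within eta of it
   lie in two intervals of length eta / delta, where delta separates the slopes.
   So the bad parameters have measure about N^3 a_(n+1) / a_n, up to factors
   4^n, and this tends to 0 because N^3 is about 2^(3 2^n) whereas
   a_(n+1) / a_n = O(2^(- 4 2^n)). *)
Require Import Defs.
From mathcomp Require Import all_boot all_order all_algebra.
From mathcomp Require Import all_classical all_reals all_analysis.
From mathcomp Require Import measurable_realfun.
From mathcomp Require Import zify ring lra.

Set Implicit Arguments.
Unset Strict Implicit.
Unset Printing Implicit Defensive.

Import Order.TTheory GRing.Theory Num.Theory.
Import numFieldNormedType.Exports.
(* MathComp-Analysis has another [shift]. *)
Import Defs.

Local Open Scope ring_scope.

(** * Simple cycles of a binary automaton *)

Section automaton.
Context (V : finType) (step : V -> bool -> V).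
Implicit Types (b : {ffun V -> bool}) (u v : V) (s : seq bool).

Definition follow b u : V := step u (b u).

(* A simple cycle visits each vertex at most once, so it is traced by a policy
   choosing one outgoing letter per vertex. *)
Definition cycle_edges b v : {set V * bool} :=
  [set (u, b u) | u in fconnect (follow b) v].

Definition cycles : {set {set V * bool}} :=
  [set cycle_edges p.1 p.2 | p : {ffun V -> bool} * V
     & fconnect (follow p.1) (follow p.1 p.2) p.2].

Lemma card_cycles : (#|cycles| <= 2 ^ #|V| * #|V|)%N.
Proof.
rewrite (leq_trans (leq_imset_card _ _))// (leq_trans (max_card _))//.
by rewrite card_prod card_ffun card_bool.
Qed.

Lemma cycle_edgesE b v e :
  (e \in cycle_edges b v) = fconnect (follow b) v e.1 && (e.2 == b e.1).
Proof.
apply/imsetP/andP => [[u uv ->]//|[ve /eqP eb]].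
by exists e.1 => //; rewrite -eb; case: (e).
Qed.

Lemma card_cycle_edges b v : #|cycle_edges b v| = order (follow b) v.
Proof. by rewrite card_imset// => u u' []. Qed.

Lemma card_cycle_gt0 E : E \in cycles -> (0 < #|E|)%N.
Proof. by case/imsetP => -[b v] _ ->; rewrite card_cycle_edges order_gt0. Qed.

Lemma card_cycle_le E : E \in cycles -> (#|E| <= #|V|)%N.
Proof. by case/imsetP => -[b v] _ ->; rewrite card_cycle_edges max_card. Qed.

Fixpoint walk_edges v s : seq (V * bool) :=
  if s is c :: s' then (v, c) :: walk_edges (step v c) s' else [::].

Lemma walk_edges_cat v s1 s2 :
  walk_edges v (s1 ++ s2) = walk_edges v s1 ++ walk_edges (foldl step v s1) s2.
Proof. by elim: s1 v => //= c s1 IH v; rewrite IH. Qed.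

Lemma size_walk_edges v s : size (walk_edges v s) = size s.
Proof. by elim: s v => //= c s IH v; rewrite IH. Qed.

Lemma unzip1_walk_edges v s :
  unzip1 (walk_edges v s) = belast v (scanl step v s).
Proof. by elim: s v => //= c s IH v; rewrite IH. Qed.

Lemma last_scanl_step v s : last v (scanl step v s) = foldl step v s.
Proof. by elim: s v => //= c s IH v. Qed.

Lemma walk_follow b v s :
  (forall e, e \in walk_edges v s -> b e.1 = e.2) ->
  fpath (follow b) v (scanl step v s).
Proof.
elim: s v => //= c s IH v bE; rewrite IH ?andbT => [|e es]; last first.
  by apply: bE; rewrite inE es orbT.
by rewrite /follow (bE (v, c)) ?mem_head/=.
Qed.

Lemma uniq_unzip1_inj (T T' : eqType) (l : seq (T * T')) x y y' :
  uniq (unzip1 l) -> (x, y) \in l -> (x, y') \in l -> y = y'.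
Proof.
elim: l => //= -[z w] l IH /andP[zl ul]; rewrite !inE.
have notin t : (z, t) \notin l by apply: contra zl => /(map_f fst).
case/orP => [/eqP[xz yw]|xl]; case/orP => [/eqP[xz' yw']|xl'].
- by rewrite yw yw'.
- by have := notin y'; rewrite -xz xl'.
- by have := notin y; rewrite -xz' xl.
- exact: IH.
Qed.

Lemma closed_walk_cycle v s : s != [::] -> foldl step v s = v ->
  uniq (scanl step v s) ->
  uniq (walk_edges v s) /\ [set e in walk_edges v s] \in cycles.
Proof.
move=> s0 sv us.
(* Off the walk this policy is [false], which is harmless: only its values at vertices of the walk
   enter the cycle. *)
pose b : {ffun V -> bool} := [ffun u => (u, true) \in walk_edges v s].
have [q qE] : exists q, scanl step v s = rcons q v.
  case: s s0 sv {us b} => //= c s _ sv; eexists.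
  by rewrite lastI last_scanl_step sv.
have p1 : unzip1 (walk_edges v s) = v :: q.
  by rewrite unzip1_walk_edges qE belast_rcons.
have uvq : uniq (v :: q) by rewrite cons_uniq -rcons_uniq -qE.
have bE e : e \in walk_edges v s -> b e.1 = e.2.
  case: e => u c es; rewrite ffunE/=; apply/idP/idP => [et|cT]; last first.
    by move: es; rewrite cT.
  by rewrite -(uniq_unzip1_inj _ et es) ?p1.
have vq : fcycle (follow b) (v :: q).
  by rewrite /= -qE; exact: walk_follow.
have vE := fconnect_cycle vq (mem_head v q).
split; first by apply: (@map_uniq _ _ fst); rewrite [map _ _]p1.
apply/imsetP; exists (b, v) => /=.
  by rewrite inE/= fconnect_f (cycle_orbit_cycle vq)// mem_head.
apply/setP => -[u c]; rewrite inE cycle_edgesE/= vE -p1.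
apply/idP/andP => [es|[/mapP[[u' c'] es /= ->] /eqP->]].
  by split; [exact: (map_f fst es)|rewrite (bE _ es)].
by rewrite (bE _ es).
Qed.

(** Induction removes the first letter, so the remaining vertices may be assumed distinct; if the
    start [v] recurs among them, the walk is cut at its first return to [v]. *)
Lemma walk_has_cycle v s : uniq (v :: scanl step v s) \/
  exists s1 s2 s3, [/\ s = s1 ++ s2 ++ s3, s2 != [::],
    foldl step (foldl step v s1) s2 = foldl step v s1,
    uniq (walk_edges (foldl step v s1) s2) &
    [set e in walk_edges (foldl step v s1) s2] \in cycles].
Proof.
elim: s v => [|c s IH] v; first by left.
have [us|[s1 [s2 [s3 [-> s20 s2E us2 cs2]]]]] := IH (step v c); last first.
  by right; exists (c :: s1), s2, s3.
have [vs|vs] := boolP (v \in scanl step v (c :: s)); last first.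
  by left; rewrite cons_uniq vs.
(* [scanl] omits the start, so the vertex at index i is reached after i + 1 letters. *)
right; pose k := (index v (scanl step v (c :: s))).+1.
have takeE : scanl step v (take k (c :: s)) = take k (scanl step v (c :: s)).
  elim: (c :: s) (v) k => // c' s' IH' v' [|k']//=.
  by rewrite IH'.
have ut : uniq (scanl step v (take k (c :: s))).
  by rewrite takeE; apply/take_uniq.
have foldv : foldl step v (take k (c :: s)) = v.
  rewrite -last_scanl_step takeE -nth_last size_take.
  have kS : (k <= size (scanl step v (c :: s)))%N by rewrite index_mem.
  rewrite (_ : (if _ then _ else _) = k); last by case: ltngtP kS => //.
  by rewrite nth_take//= nth_index.
exists [::], (take k (c :: s)), (drop k (c :: s)).
have [uw cw] := closed_walk_cycle (s := take k (c :: s)) isT foldv ut.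
by split => //=; rewrite cat_take_drop.
Qed.

(** Pigeonhole: the walk has [size s + 1] vertices, more than [#|V|]. *)
Lemma long_walk_has_cycle v s : (#|V| <= size s)%N ->
  exists s1 s2 s3, [/\ s = s1 ++ s2 ++ s3, s2 != [::],
    foldl step (foldl step v s1) s2 = foldl step v s1,
    uniq (walk_edges (foldl step v s1) s2) &
    [set e in walk_edges (foldl step v s1) s2] \in cycles].
Proof.
move=> Vs; have [us|//] := walk_has_cycle v s.
have := max_card (mem (v :: scanl step v s)).
by rewrite (card_uniqP us) /= size_scanl ltnNge Vs.
Qed.

Lemma cycles_neq0 (v : V) : exists E, E \in cycles.
Proof.
have [|s1 [s2 [s3 [_ _ _ _ E]]]] := @long_walk_has_cycle v (nseq #|V| true).
  by rewrite size_nseq.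
by eexists; exact: E.
Qed.

(** Excising a simple cycle does not decrease the sum, and a walk of fewer than [#|V|] edges
    contributes at most [M] per edge. *)
Lemma walk_sum_bounded (R : realDomainType) (G : V * bool -> R) :
  (forall E, E \in cycles -> \sum_(e in E) G e <= 0) ->
  exists K, forall v s, \sum_(e <- walk_edges v s) G e <= K.
Proof.
move=> G0; pose M := \sum_e `|G e|.
have GM e : G e <= M.
  by rewrite /M (bigD1 e)//= (le_trans (ler_norm _))// lerDl sumr_ge0.
have sumM r : \sum_(e <- r) G e <= M *+ size r.
  elim: r => [|e r IH]; first by rewrite big_nil.
  by rewrite big_cons/= mulrS lerD.
exists (M *+ #|V|) => v s; have [k] := ubnP (size s).
elim: k s v => // k IH s v; rewrite ltnS => sk.
have [sV|/(long_walk_has_cycle v)] := ltnP (size s) #|V|.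
  rewrite (le_trans (sumM _))// size_walk_edges -(subnKC (ltnW sV)) mulrnDr.
  by rewrite lerDl mulrn_wge0// sumr_ge0.
move=> [s1 [s2 [s3 [sE s20 s2E us2 /G0 cs2]]]].
(* Since [s2] is closed, [s1 ++ s3] is again a walk, to which the induction applies. *)
rewrite sE !walk_edges_cat !big_cat/= s2E addrCA -[leRHS]add0r lerD//; last first.
  rewrite -big_cat/= -walk_edges_cat; apply: IH; apply: leq_trans sk.
  by rewrite sE !size_cat; case: s2 s20 {sE s2E us2 cs2} => //= ? ?; lia.
rewrite big_uniq//=; apply: le_trans cs2; rewrite le_eqVlt; apply/orP; left.
by apply/eqP/eq_bigl => e; rewrite inE.
Qed.
End automaton.

(** * Words and Birkhoff sums *)

Local Open Scope classical_set_scope.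
Local Open Scope ring_scope.

Section words.
Context (n : nat).
Implicit Types (u v : n.-tuple bool) (x y : cantor_space).
Implicit Types (b : {ffun n.-tuple bool -> bool}).

(* The default value [c] of [nth] is the new last letter. *)
Definition word_step v (c : bool) : n.-tuple bool :=
  [tuple nth c v i.+1 | i < n].

Definition window x : n.-tuple bool := [tuple x i | i < n].

Definition edge x : n.-tuple bool * bool := (window x, x n).

Lemma nth_window d x i : (i < n)%N -> nth d (window x) i = x i.
Proof. by move=> lt_in; rewrite -(tnth_nth d _ (Ordinal lt_in)) tnth_mktuple. Qed.

Lemma nth_word_step d v c i : (i < n)%N -> nth d (word_step v c) i = nth c v i.+1.
Proof. by move=> lt_in; rewrite -(tnth_nth d _ (Ordinal lt_in)) tnth_mktuple. Qed.

Lemma window_shift x : window (shift x) = word_step (window x) (x n).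
Proof.
apply: eq_from_tnth => i; rewrite !tnth_mktuple /shift.
have [iltn|] := ltnP i.+1 n; first by rewrite nth_window.
move=> nlei; rewrite nth_default ?size_tuple//.
by congr (x _); apply/eqP; rewrite eqn_leq nlei ltn_ord.
Qed.

Lemma walk_edges_window x N :
  walk_edges word_step (window x) [seq x (n + k)%N | k <- iota 0 N] =
  [seq edge (iter k shift x) | k <- iota 0 N].
Proof.
elim: N x => //= N IH x; rewrite addn0 -window_shift; congr cons.
rewrite (iotaDl 1 0) -!map_comp.
rewrite (_ : map _ _ = [seq shift x (n + k)%N | k <- iota 0 N]); last first.
  by apply: eq_map => k /=; rewrite /shift add1n addnS.
rewrite IH; apply: eq_map => k /=; by rewrite -iterSr.
Qed.

(** The label sequence of the walk from [u] along [b]; the first letter of each visited word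
    suffices to record it. *)
Definition policy_point b u : cantor_space :=
  fun i => nth false (iter i (follow word_step b) u) 0.

Lemma shift_policy_point b u :
  shift (policy_point b u) = policy_point b (follow word_step b u).
Proof. by apply/funext => i; rewrite /shift /policy_point iterSr. Qed.

Lemma iter_shift_policy_point b u k :
  iter k shift (policy_point b u) = policy_point b (iter k (follow word_step b) u).
Proof. by elim: k => //= k ->; exact: shift_policy_point. Qed.

Hypothesis n_gt0 : (0 < n)%N.

Lemma nth_iter_follow b u k i : (k + i < n)%N ->
  nth false (iter k (follow word_step b) u) i = nth false u (k + i).
Proof.
elim: k u i => // k IH u i kin; rewrite iterSr IH; last by lia.
rewrite nth_word_step; last by lia.
by rewrite addSn; apply: set_nth_default; rewrite size_tuple.
Qed.

Lemma window_policy_point b u : window (policy_point b u) = u.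
Proof.
apply: eq_from_tnth => i; rewrite tnth_mktuple (tnth_nth false) /policy_point.
by rewrite nth_iter_follow addn0.
Qed.

Lemma edge_policy_point b u : edge (policy_point b u) = (u, b u).
Proof.
rewrite /edge window_policy_point /policy_point.
(* The letter appended by the first step sits at the end of the word and comes to the front after n
   - 1 further steps. *)
have -> : iter n (follow word_step b) u =
    iter n.-1 (follow word_step b) (follow word_step b u).
  by rewrite -iterSr prednK.
rewrite nth_iter_follow ?addn0 ?prednK// nth_word_step ?prednK//.
by rewrite nth_default// size_tuple.
Qed.

(** The window gives the first [n] letters, and each step that obeys [b] determines one more. *)
Lemma policy_run_agree b x r :
  (forall k, (k < r)%N -> iter k shift x n = b (window (iter k shift x))) ->
  forall i, (i < n + r)%N -> x i = policy_point b (window x) i.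
Proof.
elim: r x => [|r IH] x bx i.
  rewrite addn0 => lt_in; rewrite /policy_point nth_iter_follow ?addn0//.
  by rewrite nth_window.
case: i => [_|i]; first by rewrite /policy_point/= nth_window.
rewrite addnS ltnS => ir.
have -> : x i.+1 = shift x i by [].
rewrite (IH (shift x)) //; last by move=> k kr; rewrite -iterSr; apply: bx.
by rewrite window_shift (bx 0%N isT : x n = _) -shift_policy_point.
Qed.

End words.

Section seq_dist_agree.
Context (R : realType) (a : null_seq R).

Lemma null_seq_nonincreasing i j : (i <= j)%N -> a j <= a i.
Proof. by move=> ij; rewrite (null_seq_decreasing a). Qed.

Lemma seq_dist_agree (x y : cantor_space) m :
  (forall i, (i < m)%N -> x i = y i) -> seq_dist a x y <= a m.
Proof.
move=> xy; rewrite /seq_dist; case: pselect => [h|_]; last exact/ltW/null_seq_gt0.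
case: ex_minnP => k xyk _; apply: null_seq_nonincreasing.
by rewrite leqNgt; apply: contra xyk => /xy ->.
Qed.

(** Geometric series: the terms after the first sum to at most [2 * a m.+1 <= a m]. *)
Lemma sum_halving m r : (forall k, (m <= k)%N -> a k.+1 <= a k / 2) ->
  \sum_(j < r) a (m + j)%N <= 2 * a m.
Proof.
elim: r m => [|r IH] m ha.
  by rewrite big_ord0 mulr_ge0// ltW// null_seq_gt0.
rewrite big_ord_recl addn0.
have /IH : forall k, (m.+1 <= k)%N -> a k.+1 <= a k / 2 by move=> k /ltnW/ha.
have := ha m (leqnn m).
under [X in _ -> _ -> _ + X <= _]eq_bigr do rewrite /= /bump add1n -addSnnS.
lra.
Qed.

End seq_dist_agree.

Definition mean (R : realType) (T : finType) (E : {set T}) (F : T -> R) : R :=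
  (\sum_(w in E) F w) / #|E|%:R.

(** * Birkhoff sums when one cycle beats the others by a gap *)

Section birkhoff.
Context (R : realType) (a : null_seq R) (n : nat) (n_gt0 : (0 < n)%N).
Let V : finType := (n.-tuple bool : finType).
Let step := @word_step n.
Context (f : cantor_space -> R) (L : R) (fL : lip_const a f L).
Context (F : V * bool -> R) (e : R) (fF : forall x, `|f x - F (edge n x)| <= e).
Context (b : {ffun V -> bool}) (v : V).
Let E := cycle_edges step b v.
Context (Ecycle : E \in cycles step) (eta : R) (eta_ge : 2 * e <= eta).
Context (gap : forall E', E' \in cycles step -> E' != E ->
  mean E' F + eta <= mean E F).
Context (ha : forall k, (n.+1 <= k)%N -> a k.+1 <= a k / 2).

Let beta := mean E (fun w => f (policy_point b w.1)).
(* [F'] is exact along the cycle, so that replacing [f] by [F'] only costs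
   something outside the cycle and, by [sum_run_le], when leaving it. *)
Let F' w := if w \in E then f (policy_point b w.1) else F w.
Let notE x : R := (edge n x \notin E)%:R.

(** The length of the current stay on the cycle, truncated at [N]; during this stay [x] shadows a
    point of the periodic orbit. *)
Fixpoint run_length N x : nat :=
  if N is N'.+1 then
    if edge n x \in E then (run_length N' (shift x)).+1 else 0
  else 0.

Lemma run_lengthP N x k : (k < run_length N x)%N -> edge n (iter k shift x) \in E.
Proof.
elim: N x k => //= N IH x k; case: ifP => // xE.
by case: k => // k /IH; rewrite -iterSr.
Qed.

Lemma approx_error_ge0 : 0 <= e.
Proof. exact: le_trans (fF (fun=> true)). Qed.

(** If r edges on the cycle follow the present one, [x] and its periodic shadow agree on n + 1 + r
    letters, at cost [L * a (n.+1 + r)]; a whole stay thus costs at most [2 * L * a n.+1]. This is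
    charged to the preceding edge off the cycle, together with the error [e] there. The initial
    stay, preceded by none, is the last term. *)
Lemma sum_run_le N x : \sum_(k < N) (f (iter k shift x) - F' (edge n (iter k shift x)))
  <= (e + 2 * L * a n.+1) * (\sum_(k < N) notE (iter k shift x))
     + L * \sum_(j < run_length N x) a (n.+1 + j)%N.
Proof.
have L0 := lip_const_ge0 fL.
elim: N x => [|N IH] x; first by rewrite !big_ord0 !mulr0 addr0.
have sumS (h : cantor_space -> R) : \sum_(k < N.+1) h (iter k shift x) =
    h x + \sum_(k < N) h (iter k shift (shift x)).
  by rewrite big_ord_recl; congr (_ + _); apply: eq_bigr => k _; rewrite -iterSr.
rewrite (sumS (fun y => f y - F' (edge n y))) (sumS notE) /=.
have := IH (shift x); case: ifPn => /= xE IHx.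
  have -> : F' (edge n x) = f (policy_point b (window n x)) by rewrite /F' xE.
  have -> : notE x = 0 by rewrite /notE xE.
  have d : f x - f (policy_point b (window n x)) <=
      L * a (n.+1 + run_length N (shift x))%N.
    apply: le_trans (ler_norm _) _; apply: le_trans (fL _ _) _.
    rewrite ler_wpM2l// addSnnS; apply: seq_dist_agree => i.
    apply: policy_run_agree => // k kr.
    have := @run_lengthP N.+1 x k; rewrite /= xE => /(_ kr).
    by rewrite cycle_edgesE => /andP[_ /eqP].
  by rewrite big_ord_recr/= add0r; lra.
have -> : F' (edge n x) = F (edge n x) by rewrite /F' (negbTE xE).
have -> : notE x = 1 by rewrite /notE xE.
have d : f x - F (edge n x) <= e by apply: le_trans (ler_norm _) (fF x).
have := ler_wpM2l L0 (sum_halving (run_length N (shift x)) ha).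
rewrite big_ord0; lra.
Qed.

Lemma birkhoff_bound : exists K, forall N x,
  \sum_(k < N) (f (iter k shift x)
    + (eta - 3 * e - 2 * L * a n.+1) * notE (iter k shift x)) <= N%:R * beta + K.
Proof.
have L0 := lip_const_ge0 fL.
have F'E : mean E F' = beta.
  by rewrite /mean /beta; congr (_ / _); apply: eq_bigr => w wE; rewrite /F' wE.
have F'F w : `|F' w - F w| <= e.
  rewrite /F'; case: ifPn => [|_]; last by rewrite subrr normr0 approx_error_ge0.
  rewrite cycle_edgesE => /andP[_ /eqP w2].
  rewrite {2}(_ : w = edge n (policy_point b w.1)) ?fF// edge_policy_point// -w2.
  by case: (w).
have mF' E' : E' \in cycles step -> `|mean E' F' - mean E' F| <= e.
  move=> cE'; have E'0 : 0 < #|E'|%:R :> R by rewrite ltr0n (card_cycle_gt0 cE').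
  rewrite /mean -mulrBl normrM normfV (ger0_norm (ltW E'0)) ler_pdivrMr//.
  rewrite -sumrB (le_trans (ler_norm_sum _ _ _))//.
  by rewrite mulr_natr -sumr_const ler_sum.
(* The sum of [G] over [E] vanishes. On another simple cycle the mean of [F'] lies at least
   [eta - 2 * e] below [beta], one [e] being lost for each of the two means, so a bonus of
   [eta - 2 * e] per edge off [E] keeps the sum nonpositive. *)
pose G w := F' w - beta + (eta - 2 * e) * (w \notin E)%:R.
have [|K KP] := @walk_sum_bounded V step R G.
  move=> E' cE'; have E'0 : 0 < #|E'|%:R :> R by rewrite ltr0n (card_cycle_gt0 cE').
  rewrite big_split/= sumrB sumr_const.
  have -> : \sum_(w in E') F' w = mean E' F' * #|E'|%:R.
    by rewrite /mean divfK// gt_eqF.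
  have [->|E'E] := eqVneq E' E.
    rewrite F'E [X in _ + X]big1 ?addr0 ?mulr_natr ?subrr// => w ->.
    by rewrite mulr0.
  have : \sum_(i in E') (eta - 2 * e) * (i \notin E)%:R <= (eta - 2 * e) * #|E'|%:R.
    rewrite mulr_natr -sumr_const ler_sum// => w _.
    by rewrite ler_piMr// ?subr_ge0//; case: (_ \notin _).
  have := mF' _ cE'; have := mF' _ Ecycle; rewrite F'E !ler_norml.
  have := gap cE' E'E.
  move=> h1 /andP[h2 h3] /andP[h4 h5] h6; rewrite -[beta *+ _]mulr_natr.
  have : (mean E' F' - beta + (eta - 2 * e)) * #|E'|%:R <= 0.
    by apply: mulr_le0_ge0; [lra|exact: ltW].
  lra.
(* The second term pays for the initial stay on the cycle. *)
exists (K + L * (2 * a n.+1)) => N x.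
have := KP (window n x) [seq x (n + k)%N | k <- iota 0 N].
rewrite walk_edges_window big_map -/(index_iota 0 N) -{1}(subn0 N) big_mkord.
have h1 := sum_run_le N x.
have h2 := ler_wpM2l L0 (sum_halving (run_length N x) ha).
rewrite /G !big_split/= !sumrN -!mulr_sumr sumr_const card_ord -[_ *+ N]mulr_natl.
move: h1; rewrite big_split/= sumrN -/(notE _) /notE.
rewrite (_ : _ * (N%:R / _) = N%:R * beta); last by rewrite /beta /mean mulrCA.
(* The third [e] is the error off the cycle, from [sum_run_le]. *)
have combine (S S1 S2 D B T q c K' : R) : S - S1 <= (e + c) * S2 + D ->
    S1 - B + (q - 2 * e) * S2 <= K' -> D <= T ->
    S + (q - 3 * e - c) * S2 <= B + (K' + T) by lra.
by move=> h1 h3; exact: combine h1 h3 h2.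
Qed.

End birkhoff.

(** * Invariant measures on the Cantor space *)

Lemma nbhs_cylinder (x : cantor_space) m :
  \forall y \near x, forall i, (i < m)%N -> y i = x i.
Proof.
elim: m => [|m IH]; first by near=> y.
have xm : \forall y \near x, (y : cantor_space) m = x m.
  have : nbhs (x m) [set x m] by rewrite nbhs_principalE; exact/principal_filterP.
  by move/(@proj_continuous nat (fun=> bool) m x).
near=> y => i; rewrite ltnS leq_eqVlt => /predU1P[->|].
  by near: y.
by move: i; near: y.
Unshelve. all: by end_near. Qed.

Lemma lip_continuous (R : realType) (a : null_seq R) f L :
  lip_const a f L -> continuous f.
Proof.
move=> fL x; apply/cvgrPdist_le => e e0.
have L0 := lip_const_ge0 fL.
have [m am] : exists m, L * a m <= e.
  (* [L + 1] avoids a division by [L], which may be 0. *)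
  have /cvgrPdist_le/(_ (e / (L + 1))) := null_seq_cvg0 a.
  case; first by rewrite divr_gt0//; lra.
  move=> m _ /(_ m (leqnn m)); rewrite sub0r normrN ger0_norm; last first.
    exact/ltW/null_seq_gt0.
  move=> am; exists m; rewrite (le_trans (ler_wpM2l L0 am))//.
  rewrite mulrCA ger_pMr// ler_pdivrMr; lra.
have := nbhs_cylinder x m; apply: filterS => y yx.
rewrite (le_trans (fL _ _))// (le_trans _ am)// ler_wpM2l//.
by apply: seq_dist_agree => i /yx.
Qed.

Section borel_maps.
Context (T T' : ptopologicalType).

Lemma continuous_borel_measurable (f : T -> T') : continuous f ->
  measurable_fun [set: borel T] (f : borel T -> borel T').
Proof.
move=> /continuousP cf.
apply: (measurability _ (erefl : @measurable _ (borel T') = <<s @open T' >>)).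
by move=> _ [U oU <-]; rewrite setTI; apply: sub_sigma_algebra; exact: cf.
Qed.

End borel_maps.

Lemma continuous_measurable_real (R : realType) (T : ptopologicalType)
  (f : T -> R) : continuous f -> measurable_fun [set: borel T] (f : borel T -> R).
Proof.
move=> /continuousP cf; apply: (measurability _ (RGenOpens.measurableE R)).
move=> _ [_ [x [y ->] <-]]; rewrite setTI; apply: sub_sigma_algebra.
by apply: cf; exact: interval_open.
Qed.

Lemma shift_continuous : continuous shift.
Proof.
move=> x; apply/cvg_sup => i A [B [[C oC <-] Cx] BA].
have := nbhs_cylinder x i.+2; apply: filterS => y yx; apply: BA.
by move: Cx; rewrite /preimage/= /shift (yx i.+1).
Qed.

Lemma shift_measurable :
  measurable_fun [set: borel cantor_space]
    (shift : borel cantor_space -> borel cantor_space).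
Proof.
exact: (@continuous_borel_measurable cantor_space cantor_space _ shift_continuous).
Qed.

(** The values are finitely many, and points with distinct edges differ within the first n + 1
    letters, hence lie at distance at least [a n]. *)
Lemma edge_fun_lip (R : realType) (a : null_seq R) n (G : n.-tuple bool * bool -> R) :
  exists L, lip_const a (fun x => G (edge n x)) L.
Proof.
pose M := \sum_w `|G w|.
have GM w : `|G w| <= M by rewrite /M (bigD1 w)//= lerDl sumr_ge0.
have M0 : 0 <= M by exact: sumr_ge0.
exists ((M + M) / a n) => x y.
have an := null_seq_gt0 a n.
have [xy|] := pselect (edge n x = edge n y).
  by rewrite xy subrr normr0 mulr_ge0 ?seq_dist_ge0// divr_ge0 ?addr_ge0// ltW.
move=> xy; rewrite (le_trans (ler_normB _ _))// (le_trans (lerD (GM _) (GM _)))//.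
rewrite -mulrA ler_peMr ?addr_ge0//.
rewrite mulrC ler_pdivlMr// mul1r /seq_dist; case: pselect => [h|]; last first.
  move=> h; exfalso; apply: xy; congr (edge n _); apply/funext => i.
  by apply/eqP; apply: contrapT => /negP xyi; apply: h; exists i.
case: ex_minnP => k _ km; apply: null_seq_nonincreasing.
rewrite leqNgt; apply/negP => nk; apply: xy.
have xyi i : (i <= n)%N -> x i = y i.
  by move=> iN; apply/eqP; apply: contraT => /km; lia.
congr (_, _); last exact: xyi.
by apply: eq_from_tnth => i; rewrite !tnth_mktuple; apply/xyi/ltnW.
Qed.

Lemma measurable_orbit p : measurable
  ([set iter i shift p | i in [set: nat]] : set (borel cantor_space)).
Proof.
rewrite (_ : [set iter i shift p | i in _] =
    \bigcup_(i in [set: nat]) [set iter i shift p]); last first.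
  by apply/seteqP; split=> [_ [i _ <-]|_ [i _ ->]]; exists i.
apply: bigcup_measurable => i _.
have cl : closed [set iter i shift p].
  exact/accessible_closed_set1/hausdorff_accessible/cantor_space_hausdorff.
rewrite -[X in measurable X]setCK; apply: measurableC.
by apply: sub_sigma_algebra; exact: closed_openC.
Qed.

Section invariant_integral.
Context (R : realType) (nu : probability (borel cantor_space) R).
Hypothesis nu_inv : invariant nu.
Implicit Types (f g : cantor_space -> R).

Definition bounded_measurable g :=
  measurable_fun [set: borel cantor_space] (g : borel cantor_space -> R) /\
  exists M, forall x, `|g x| <= M.

Lemma bounded_measurable_cst c : bounded_measurable (fun=> c).
Proof. by split; [exact: measurable_cst|exists `|c|]. Qed.

Lemma bounded_measurableD f g : bounded_measurable f -> bounded_measurable g ->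
  bounded_measurable (fun x => f x + g x).
Proof.
move=> [mf [M fM]] [mg [N gN]]; split; first exact: measurable_funD.
by exists (M + N) => x; rewrite (le_trans (ler_normD _ _))// lerD.
Qed.

Lemma bounded_measurableZ k f : bounded_measurable f ->
  bounded_measurable (fun x => k * f x).
Proof.
move=> [mf [M fM]]; split; first exact: measurable_funM.
by exists (`|k| * M) => x; rewrite normrM ler_wpM2l.
Qed.

Lemma bounded_measurable_iter k g : bounded_measurable g ->
  bounded_measurable (fun x => g (iter k shift x)).
Proof.
elim: k => // k IH [mg [M gM]].
have [mgk _] := IH (conj mg (ex_intro _ M gM)).
split; last by exists M => x.
rewrite (_ : (fun x => _) = (fun x => g (iter k shift x)) \o shift).
  exact: (measurableT_comp mgk shift_measurable).
by apply/funext => x /=; rewrite -iterSr.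
Qed.

Lemma bounded_measurable_sum N g : bounded_measurable g ->
  bounded_measurable (fun x => \sum_(k < N) g (iter k shift x)).
Proof.
move=> bg; elim: N => [|N IH].
  by under eq_fun do rewrite big_ord0; exact: bounded_measurable_cst.
under eq_fun do rewrite big_ord_recr.
by apply: bounded_measurableD => //; exact: bounded_measurable_iter.
Qed.

Lemma bounded_measurable_integrable g : bounded_measurable g ->
  nu.-integrable [set: borel cantor_space] (EFin \o g).
Proof.
move=> [mg [M gM]]; apply: measurable_bounded_integrable => //.
  by rewrite [X in (X < _)%E](_ : _ = 1%E) ?ltry//; exact: probability_setT.
by exists M; split; [exact: num_real|move=> y My x _; exact: le_trans (gM x) (ltW My)].
Qed.

Lemma integral_shift g : bounded_measurable g ->
  \int[nu]_x g (shift x) = \int[nu]_x g x.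
Proof.
move=> bg; rewrite /Rintegral; congr fine.
transitivity (\int[pushforward nu
    (shift : borel cantor_space -> borel cantor_space)]_x (g x)%:E)%E.
  rewrite integral_pushforward//.
  - exact: shift_measurable.
  - by case: bg => mg _; apply/measurable_EFinP.
  - exact: (bounded_measurable_integrable (bounded_measurable_iter 1 bg)).
by apply: eq_measure_integral => [|? A mA _]; [exact: shift_measurable|exact: nu_inv].
Qed.

Lemma integral_birkhoff N g : bounded_measurable g ->
  \int[nu]_x (\sum_(k < N) g (iter k shift x)) = N%:R * \int[nu]_x g x.
Proof.
move=> bg; elim: N => [|N IH].
  rewrite mul0r; under eq_Rintegral do rewrite big_ord0.
  by rewrite Rintegral_cst// mul0r.
under eq_Rintegral do rewrite big_ord_recr/=.
rewrite RintegralD//; last 2 first.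
- exact: bounded_measurable_integrable (bounded_measurable_sum _ _).
- exact: bounded_measurable_integrable (bounded_measurable_iter _ _).
rewrite IH -natr1 mulrDl mul1r; congr (_ + _).
elim: N {IH} => // N IH; rewrite -IH -[RHS]integral_shift; last first.
  exact: bounded_measurable_iter.
by apply: eq_Rintegral => x _; rewrite -iterSr.
Qed.

(** By invariance, integrating the bound shows that [N] times the excess of the integral over [beta]
    is at most [K] for every [N]. *)
Lemma integral_le_birkhoff g beta K : bounded_measurable g ->
  (forall N x, \sum_(k < N) g (iter k shift x) <= N%:R * beta + K) ->
  \int[nu]_x g x <= beta.
Proof.
move=> bg gK; rewrite leNgt; apply/negP => gb.
have h N : N%:R * (\int[nu]_x g x - beta) <= K.
  rewrite mulrBr -integral_birkhoff// lerBlDl.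
  have -> : N%:R * beta + K = \int[nu]_x (N%:R * beta + K).
    rewrite Rintegral_cst// -[LHS]mulr1; congr (_ * _).
    exact: (esym (congr1 fine (probability_setT nu))).
  apply: le_Rintegral => //.
    exact: bounded_measurable_integrable (bounded_measurable_sum _ _).
  exact: bounded_measurable_integrable (bounded_measurable_cst _).
have d0 : 0 < \int[nu]_x g x - beta by rewrite subr_gt0.
have := h (Num.truncn (K / (\int[nu]_x g x - beta))).+1.
rewrite -ler_pdivlMr// leNgt truncnS_gt//.
Qed.

(* Birkhoff sums of length [k] are constant on the orbit. *)
Lemma integral_periodic_orbit p k g : (0 < k)%N -> iter k shift p = p ->
  nu (~` [set iter i shift p | i in [set: nat]]) = 0%E -> bounded_measurable g ->
  \int[nu]_x g x = (\sum_(i < k) g (iter i shift p)) / k%:R.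
Proof.
move=> k0 kp nuO bg.
have S j : \sum_(i < k) g (iter i shift (iter j shift p)) =
    \sum_(i < k) g (iter i shift p).
  elim: j => // j <-; rewrite iterS; set q := iter j shift p.
  have qk : iter k shift q = q by rewrite /q -iterD addnC iterD kp.
  rewrite [LHS](eq_bigr (fun i : 'I_k => g (iter i.+1 shift q))); last first.
    by move=> i _; rewrite -iterSr.
  case: k k0 qk {kp} => // k _ qk.
  by rewrite big_ord_recr [RHS]big_ord_recl qk addrC.
have k0' : k%:R != 0 :> R by rewrite pnatr_eq0 -lt0n.
apply: (mulfI k0'); rewrite mulrC [RHS]mulrC divfK// [LHS]mulrC -integral_birkhoff//.
set c := RHS; transitivity (\int[nu]_x c).
  rewrite /Rintegral; congr fine; apply: ae_eq_integral => //.
  - by apply/measurable_EFinP; case: (bounded_measurable_sum k bg).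
  - exists (~` [set iter i shift p | i in [set: nat]]); split => //.
      by apply: measurableC; exact: measurable_orbit.
    by move=> x /=; apply: contra_not => -[i _ <-] _; rewrite S.
rewrite Rintegral_cst// -[RHS]mulr1; congr (_ * _).
exact: (congr1 fine (probability_setT nu)).
Qed.

End invariant_integral.

Lemma lip_bounded_measurable (R : realType) (a : null_seq R) (g : cantor_space -> R) M :
  lip_const a g M -> bounded_measurable g.
Proof.
move=> gM; split; first exact: continuous_measurable_real (lip_continuous gM).
exists (`|g point| + M * a 0%N) => x.
rewrite -(subrK (g point) (g x)) (le_trans (ler_normD _ _))// addrC lerD2l.
rewrite (le_trans (gM _ _))// ler_wpM2l ?seq_dist_le//.
exact: lip_const_ge0 gM.
Qed.

(** * Measures carried by periodic orbits *)

Section average_dirac.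
Context d (T : measurableType d) (R : realType) (x : nat -> T) (k : nat).

(* [mnormalize] takes its second argument as default value when [k = 0]. *)
Definition average_dirac : probability T R :=
  mnormalize (msum (fun i => @dirac _ T (x i) R) k) (@dirac _ T (x 0%N) R).

Lemma average_diracE A : (0 < k)%N ->
  average_dirac A = ((\sum_(i < k) (x i \in A)%:R) / k%:R)%:E.
Proof.
move=> k0.
pose m : {measure set T -> \bar R} := msum (fun i => @dirac _ T (x i) R) k.
rewrite /average_dirac/= /mnormalize -/m.
have dE B : m B = (\sum_(i < k) (x i \in B)%:R)%:E.
  by rewrite /m/= /msum -sumEFin; apply: eq_bigr => i _; rewrite /= diracE.
rewrite !dE (eq_bigr (fun=> 1)) => [|i _]; last by rewrite in_setT.
by rewrite sumr_const card_ord eqe pnatr_eq0 (gtn_eqF k0)/= dE -EFinM.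
Qed.

End average_dirac.

Section orbit_measure.
Context (R : realType) (p : cantor_space) (k : nat).

Definition orbit_measure : probability (borel cantor_space) R :=
  average_dirac R (fun i => iter i shift p : borel cantor_space) k.

Hypotheses (k_gt0 : (0 < k)%N) (kp : iter k shift p = p).

Lemma orbit_measureE (A : set (borel cantor_space)) :
  orbit_measure A = ((\sum_(i < k) (iter i shift p \in A)%:R) / k%:R)%:E.
Proof. exact: average_diracE. Qed.

Lemma orbit_measure_invariant : invariant orbit_measure.
Proof.
move=> A mA; rewrite !orbit_measureE; congr (_ / _)%:E.
have inE i : (iter i shift p \in shift @^-1` A) = (iter i.+1 shift p \in A).
  by apply/idP/idP; rewrite !inE.
under eq_bigr do rewrite inE.
case: k k_gt0 kp => // k' _ k'p.
by rewrite big_ord_recr [RHS]big_ord_recl k'p addrC.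
Qed.

Lemma orbit_measure_support :
  orbit_measure (~` [set iter i shift p | i in [set: nat]]) = 0%E.
Proof.
rewrite orbit_measureE big1 ?mul0r// => i _.
rewrite (_ : _ \in _ = false)//; apply/negP; rewrite inE => h.
by apply: h; exists i.
Qed.

Lemma orbit_measure_periodic : periodic_measure orbit_measure.
Proof.
split; first exact: orbit_measure_invariant.
by exists p, k; split => //; exact: orbit_measure_support.
Qed.

(** Applied to the indicator of [A], [integral_periodic_orbit] leaves only one possible value. *)
Lemma invariant_orbit_measure (nu : probability (borel cantor_space) R) :
  invariant nu -> nu (~` [set iter i shift p | i in [set: nat]]) = 0%E ->
  forall A, measurable A -> nu A = orbit_measure A.
Proof.
move=> nu_inv nuO A mA; rewrite orbit_measureE.
have bA : bounded_measurable (\1_A : cantor_space -> R).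
  split; first exact: measurable_indic.
  by exists 1 => x; rewrite ger0_norm// indicE; case: (_ \in _).
have := integral_periodic_orbit nu_inv k_gt0 kp nuO bA.
rewrite /Rintegral integral_indic// setIT => nuE.
rewrite -[LHS]fineK ?nuE//; last exact: fin_num_measure.
Qed.

End orbit_measure.

Lemma sum_cycle_edges (R : realType) (V : finType) (step : V -> bool -> V) b v
    (h : V -> R) :
  \sum_(w in cycle_edges step b v) h w.1 =
  \sum_(i < order (follow step b) v) h (iter i (follow step b) v).
Proof.
rewrite big_imset/= => [|u u' _ _ []//].
rewrite (eq_bigl _ _ (fconnect_orbit (follow step b) v)) -big_uniq ?orbit_uniq//.
rewrite /orbit (big_nth v) size_traject big_mkord.
by apply: eq_bigr => i _; rewrite nth_traject.
Qed.

(** * Unique maximization from a gap at one level *)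

Section locking_criterion.
Context (R : realType) (a : null_seq R) (n : nat) (n_gt0 : (0 < n)%N).
Let V : finType := (n.-tuple bool : finType).
Let step := @word_step n.
Context (b : {ffun V -> bool}) (v : V).
Context (vv : fconnect (follow step b) (follow step b v) v).
Let E := cycle_edges step b v.

Definition cycle_measure : probability (borel cantor_space) R :=
  orbit_measure R (policy_point b v) (order (follow step b) v).

Lemma iter_shift_cycle_point :
  iter (order (follow step b) v) shift (policy_point b v) = policy_point b v.
Proof.
rewrite iter_shift_policy_point; congr policy_point.
(* Two equivalent forms of cyclicity: return after [order] steps, and [vv]. *)
by apply/(orbitPcycle (f := follow step b) 2 4).
Qed.

Lemma cycle_measure_periodic : periodic_measure cycle_measure.
Proof.
by apply: orbit_measure_periodic; [exact: order_gt0|exact: iter_shift_cycle_point].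
Qed.

(** Such a point obeys the policy for ever, so it is the policy point of its window, which is a
    vertex of the cycle. *)
Lemma edges_in_cycle_orbit x : (forall k, edge n (iter k shift x) \in E) ->
  [set iter i shift (policy_point b v) | i in [set: nat]] x.
Proof.
move=> xE; have := xE 0%N; rewrite cycle_edgesE => /andP[/= vx _].
exists (findex (follow step b) v (window n x)) => //.
rewrite iter_shift_policy_point iter_findex//; apply/funext => i.
apply/esym/(@policy_run_agree n n_gt0 b x i.+1); last by lia.
by move=> k _; have := xE k; rewrite cycle_edgesE => /andP[_ /eqP].
Qed.

Context (f : cantor_space -> R) (L : R) (fL : lip_const a f L).
Context (F : V * bool -> R) (e : R) (fF : forall x, `|f x - F (edge n x)| <= e).
Context (eta : R) (eta_gt : 3 * e + 2 * L * a n.+1 < eta).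
Context (gap : forall E', E' \in cycles step -> E' != E ->
  mean E' F + eta <= mean E F).
Context (ha : forall k, (n.+1 <= k)%N -> a k.+1 <= a k / 2).

Let L_ge0 : 0 <= L := lip_const_ge0 fL.

Let leaving : set (borel cantor_space) := [set x | edge n x \notin E].

Lemma measurable_leaving : measurable leaving.
Proof.
have [M /lip_bounded_measurable[mg _]] :=
  edge_fun_lip a (fun w : V * bool => (w \notin E)%:R : R).
rewrite (_ : leaving = [set: borel cantor_space] `&`
   (fun x => (edge n x \notin E)%:R : R) @^-1` [set 1]); last first.
  rewrite setTI; apply/seteqP; split=> x; rewrite /leaving/=; first by move=> ->.
  by case: (edge n x \notin E) => //= /eqP; rewrite eq_sym oner_eq0.
exact: mg.
Qed.

(** The constant [beta] of [birkhoff_bound] is the integral of [f] against the cycle measure; that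
    bound is integrated against [nu]. *)
Lemma integral_cycle_bound (nu : probability (borel cantor_space) R) : invariant nu ->
  \int[nu]_x f x + (eta - 3 * e - 2 * L * a n.+1) * fine (nu leaving)
  <= \int[cycle_measure]_x f x.
Proof.
move=> nu_inv; have bf := lip_bounded_measurable fL.
have bl : bounded_measurable (\1_leaving : cantor_space -> R).
  split; first by apply: measurable_indic; exact: measurable_leaving.
  by exists 1 => x; rewrite ger0_norm// indicE; case: (_ \in _).
have muE : \int[cycle_measure]_x f x = mean E (fun w => f (policy_point b w.1)).
  have k0 := order_gt0 (follow step b) v.
  rewrite (integral_periodic_orbit
    (orbit_measure_invariant R k0 iter_shift_cycle_point) k0
    iter_shift_cycle_point (orbit_measure_support R _ k0) bf).
  rewrite /mean card_cycle_edges; congr (_ / _).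
  rewrite (sum_cycle_edges step b v (fun u => f (policy_point b u))).
  by apply: eq_bigr => i _; rewrite iter_shift_policy_point.
have e0 : 0 <= e by apply: le_trans (fF point).
have eta2e : 2 * e <= eta.
  have La := mulr_ge0 L_ge0 (ltW (null_seq_gt0 a n.+1)).
  by move: La eta_gt e0; rewrite -mulrA; lra.
have Ecycle : E \in cycles step.
  by apply/imsetP; exists (b, v) => //; rewrite inE.
have [K KP] := birkhoff_bound n_gt0 fL fF Ecycle eta2e gap ha.
set kappa := eta - _ - _ in KP *.
rewrite muE.
have -> : \int[nu]_x f x + kappa * fine (nu leaving) =
    \int[nu]_x (f x + kappa * \1_leaving x).
  rewrite RintegralD//; last 2 first.
  - exact: bounded_measurable_integrable.
  - exact/bounded_measurable_integrable/bounded_measurableZ.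
  rewrite RintegralZl//; last exact: bounded_measurable_integrable.
  by rewrite /Rintegral integral_indic ?setIT//; exact: measurable_leaving.
apply: (integral_le_birkhoff nu_inv (K := K)).
  exact/bounded_measurableD/bounded_measurableZ.
move=> N x; apply: le_trans (KP N x); rewrite le_eqVlt; apply/orP; left.
apply/eqP/eq_bigr => k _; congr (_ + _ * _); rewrite indicE; congr (_%:R).
by congr nat_of_bool; apply/idP/idP; rewrite inE.
Qed.

(** A maximizing [nu] gives [leaving] no mass, because the coefficient of that mass is positive. By
    invariance almost no point ever leaves the cycle, so [nu] is carried by the periodic orbit. *)
Lemma cycle_measure_unique_maximizing : unique_maximizing cycle_measure f.
Proof.
have kappa_gt0 : 0 < eta - 3 * e - 2 * L * a n.+1 by move: eta_gt; lra.
have bf := lip_bounded_measurable fL.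
have intE (nu : probability (borel cantor_space) R) :
    (\int[nu]_x (f x)%:E = (\int[nu]_x f x)%:E)%E.
  rewrite /Rintegral fineK//; apply: integrable_fin_num => //.
  exact: bounded_measurable_integrable.
have mu_inv : invariant cycle_measure by case: cycle_measure_periodic.
have mu_max : ereal_sup [set (\int[nu]_x (f x)%:E)%E | nu in
    [set nu : probability (borel cantor_space) R | invariant nu]] =
    (\int[cycle_measure]_x f x)%:E.
  apply/eqP; rewrite eq_le; apply/andP; split.
    apply: ge_ereal_sup => _ [nu nu_inv <-]; rewrite intE lee_fin.
    apply: le_trans (integral_cycle_bound nu_inv); rewrite lerDl.
    by rewrite mulr_ge0 ?fine_ge0// ltW.
  by apply: ereal_sup_ubound; exists cycle_measure => //; exact: intE.
split; first by split => //; rewrite mu_max intE.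
move=> nu [nu_inv]; rewrite mu_max intE => -[nuf].
have nul : nu leaving = 0%E.
  rewrite -[LHS]fineK ?fin_num_measure//; last exact: measurable_leaving.
  congr EFin; apply/eqP; rewrite eq_le fine_ge0// andbT.
  by have := integral_cycle_bound nu_inv; rewrite nuf gerDl pmulr_rle0.
have nulk k : nu (iter k shift @^-1` leaving) = 0%E /\
    measurable (iter k shift @^-1` leaving : set (borel cantor_space)).
  elim: k => [|k [IH mk]]; first by split => //; exact: measurable_leaving.
  rewrite (_ : iter k.+1 shift @^-1` leaving =
    shift @^-1` (iter k shift @^-1` leaving)); last first.
    by apply/funext => x; rewrite /preimage/= -iterSr.
  split; first by rewrite nu_inv.
  by rewrite -[X in measurable X]setTI; exact: shift_measurable.
apply: (invariant_orbit_measure _ iter_shift_cycle_point nu_inv).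
  exact: order_gt0.
have nul_bigcup : nu.-negligible (\bigcup_k (iter k shift @^-1` leaving)).
  apply: negligible_bigcup => k; have [nk mk] := nulk k.
  exact/negligibleP.
apply: measure_negligible; first by apply: measurableC; exact: measurable_orbit.
move: nul_bigcup; apply: negligibleS => x.
apply: contra_notP => xl; apply: edges_in_cycle_orbit => k.
by apply: contrapT => /negP xk; apply: xl; exists k.
Qed.

End locking_criterion.

(** * Weights separating cycle means *)

Lemma meanD (R : realType) (T : finType) (E : {set T}) (F G : T -> R) :
  mean E (fun w => F w + G w) = mean E F + mean E G.
Proof. by rewrite /mean big_split mulrDl. Qed.

Lemma meanZ (R : realType) (T : finType) (E : {set T}) (F : T -> R) k :
  mean E (fun w => k * F w) = k * mean E F.
Proof. by rewrite /mean -mulr_sumr mulrA. Qed.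

Lemma mean_update (R : realType) (W : finType) (E : {set W}) (F G : W -> R) w0 :
  (forall w, w != w0 -> F w = G w) ->
  mean E F - mean E G = (w0 \in E)%:R * (F w0 - G w0) / #|E|%:R.
Proof.
move=> FG; rewrite /mean -mulrBl -sumrB; congr (_ / _).
have [w0E|w0E] := boolP (w0 \in E).
  rewrite (bigD1 w0)//= big1 ?addr0 ?mul1r// => w /andP[_ /FG->].
  by rewrite subrr.
rewrite mul0r big1// => w wE; rewrite FG ?subrr//.
by apply: contraNneq w0E => <-.
Qed.

Section separation.
Context (R : realType) (W : finType) (C : {set {set W}}) (D : nat).
Hypothesis CD : forall E, E \in C -> (0 < #|E| <= D)%N.
Context (A : W -> R) (s : R) (s_gt0 : 0 < s).

(** Each edge gets one of [M] equally spaced weights, and [M] exceeds the number of pairs of cycles,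
    as the union bound requires. Changing one weight moves the mean over a cycle through that edge
    by at least [s / (M * D)], which is [2 * delta]. *)
Let M := (#|C| * #|C|).+1.
Let delta := s / (2 * M%:R * D%:R).
Let weight (k : {ffun W -> 'I_M}) w : R := s * (k w)%:R / M%:R.
Let val k E := mean E (fun w => A w + weight k w).
Let bad E E' := [set k | `|val k E - val k E'| < delta]%SET.

(* The weight at an edge of only one of the two cycles is determined, on [bad],
   by the other weights; hence [bad] contains at most one choice out of [M]. *)
Lemma bad_inj E E' w0 : E \in C -> E' \in C -> w0 \in E -> w0 \notin E' ->
  {in bad E E' &, forall k k' : {ffun W -> 'I_M},
    (forall w, w != w0 -> k w = k' w) -> k = k'}.
Proof.
move=> CE CE' w0E w0E' k k'; rewrite !inE => bk bk' kk'.
apply/ffunP => w; have [->|/kk'//] := eqVneq w w0.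
apply/eqP; apply: contraT => kw0.
have upd w1 : w1 != w0 -> A w1 + weight k w1 = A w1 + weight k' w1.
  by move=> /kk' e; rewrite /weight e.
have /andP[E0 ED] := CD CE.
have E0' : 0 < #|E|%:R :> R by rewrite ltr0n.
have D0' : 0 < D%:R :> R by rewrite ltr0n (leq_trans E0).
have ED' : #|E|%:R <= D%:R :> R by rewrite ler_nat.
have M0 : 0 < M%:R :> R by rewrite ltr0n.
have d1 := mean_update E upd; have d2 := mean_update E' upd.
rewrite w0E mul1r in d1; rewrite (negbTE w0E') mul0r mul0r in d2.
have : 2 * delta <=
    `|mean E (fun w => A w + weight k w) - mean E (fun w => A w + weight k' w)|.
  rewrite d1 opprD addrACA subrr add0r /weight -mulrBl -mulrBr.
  rewrite !normrM !normfV (gtr0_norm s_gt0) (gtr0_norm E0') (gtr0_norm M0).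
  rewrite /delta (_ : 2 * _ = s / M%:R / D%:R); last first.
    by field; rewrite (gt_eqF M0) (gt_eqF D0').
  apply: ler_pM => //.
  - by rewrite divr_ge0// ltW.
  - rewrite ler_wpM2r// ?invr_ge0 ?(ltW M0)// ler_peMr ?(ltW s_gt0)//.
    have : (k w0 : nat) != k' w0 by apply: contra_neq kw0 => /val_inj.
    case: (ltngtP (k w0) (k' w0)) => // kk _.
      by rewrite distrC -natrB ?(ltnW kk)// ger0_norm// ler1n subn_gt0.
    by rewrite -natrB ?(ltnW kk)// ger0_norm// ler1n subn_gt0.
  - by rewrite lef_pV2.
rewrite leNgt => /negP[].
have -> : 2 * delta = delta + delta by rewrite mulrDl mul1r.
(* Since [w0] is not in [E'], the mean over [E'] is the same for [k] and [k'], and the move is a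
   difference of two quantities smaller than [delta]. *)
have -> : mean E (fun w => A w + weight k w) - mean E (fun w => A w + weight k' w)
   = (val k E - val k E') - (val k' E - val k' E').
  by move: d2; rewrite /val; lra.
by rewrite (le_lt_trans (ler_normB _ _))// ltrD.
Qed.

Lemma bad_sym E E' : bad E E' = bad E' E.
Proof. by apply/setP => k; rewrite !inE distrC. Qed.

(** Overwriting the weight at [w0] by an arbitrary one is injective on the product of [bad E E'] and
    ['I_M], by [bad_inj]. *)
Lemma card_bad E E' : E \in C -> E' \in C -> E != E' ->
  (#|bad E E'| * M <= M ^ #|W|)%N.
Proof.
wlog [w0 w0E w0E'] : E E' / exists2 w0, w0 \in E & w0 \notin E'.
  move=> wl CE CE' EE'.
  have [/fintype.subsetP sEE'|/subsetPn[w0 ? ?]] := boolP (E \subset E'); last first.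
    by apply: wl => //; exists w0.
  have [sE'E|/subsetPn[w0 ? ?]] := boolP (E' \subset E).
    by move: EE'; rewrite finset.eqEsubset sE'E andbT; move/subsetPn => [w /sEE' ->].
  by rewrite bad_sym; apply: wl => //; [exists w0|rewrite eq_sym].
move=> CE CE' _.
pose upd (kj : {ffun W -> 'I_M} * 'I_M) : {ffun W -> 'I_M} :=
  [ffun w => if w == w0 then kj.2 else kj.1 w].
have : (#|finset.setX (bad E E') [set: 'I_M]%SET| <= #|{ffun W -> 'I_M}|)%N.
  rewrite -(card_in_imset (f := upd)) ?max_card// => -[k j] [k' j'].
  rewrite !finset.in_setX !finset.in_setT !andbT => bk bk' /ffunP kk'.
  have := kk' w0; rewrite !ffunE eqxx /= => ->; congr pair.
  apply: (bad_inj CE CE' w0E w0E') => // w ww0.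
  by have := kk' w; rewrite !ffunE (negbTE ww0).
by rewrite cardsX cardsT card_ord card_ffun card_ord.
Qed.

(** Union bound: fewer than [M] bad sets, each containing at most one choice out of [M], cannot
    cover all choices. *)
Lemma exists_separating : exists omega : W -> R,
  (forall w, 0 <= omega w <= s) /\
  forall E E', E \in C -> E' \in C -> E != E' ->
    s / (2 * (#|C| * #|C|).+1%:R * D%:R) <=
    `|mean E (fun w => A w + omega w) - mean E' (fun w => A w + omega w)|.
Proof.
have [k kP] : exists k : {ffun W -> 'I_M}, forall E E', E \in C -> E' \in C ->
    E != E' -> k \notin bad E E'.
  apply: contrapT => nk.
  pose P := [set q in finset.setX C C | q.1 != q.2]%SET.
  have cov : [set: {ffun W -> 'I_M}]%SET = (\bigcup_(q in P) bad q.1 q.2)%SET.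
    apply/esym/eqP; rewrite -finset.subTset; apply/fintype.subsetP => k _.
    apply: contrapT => kb; apply: nk; exists k => E E' CE CE' EE'.
    apply/negP => kE; apply: kb; apply/finset.bigcupP; exists (E, E') => //.
    by rewrite inE finset.in_setX CE CE'.
  have : (M * M ^ #|W| <= #|C| * #|C| * M ^ #|W|)%N.
    have -> : (M ^ #|W| = #|[set: {ffun W -> 'I_M}]%SET|)%N.
      by rewrite cardsT card_ffun card_ord.
    rewrite {1}cov -cardsX.
    apply: (@leq_trans (\sum_(q in P) M * #|bad q.1 q.2|)).
      rewrite -big_distrr leq_mul2l; apply/orP; right.
      elim/big_rec2: _ => [|q m B _ IH]; first by rewrite cards0.
      by rewrite (leq_trans (leq_card_setU _ _))// leq_add2l.
    apply: (@leq_trans (\sum_(q in P) M ^ #|W|)).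
      apply: leq_sum => -[E E'].
      rewrite inE finset.in_setX => /andP[/andP[/= CE CE'] EE'].
      by rewrite mulnC card_bad.
    rewrite sum_nat_const cardsT card_ffun card_ord leq_mul2r; apply/orP; right.
    by rewrite subset_leq_card//; apply/fintype.subsetP => q; rewrite inE => /andP[].
  by rewrite leq_mul2r expn_eq0/= ltnn.
exists (weight k); split=> [w|E E' CE CE' EE'].
  have M0 : 0 < M%:R :> R by rewrite ltr0n.
  rewrite /weight divr_ge0 ?mulr_ge0 ?(ltW s_gt0)//=.
  by rewrite ler_pdivrMr// ler_wpM2l ?(ltW s_gt0)// ler_nat ltnW.
by have := kP _ _ CE CE' EE'; rewrite inE -leNgt.
Qed.

End separation.

(** * Optimal cycles along a line *)

Lemma lebesgue_measure_cover (R : realType) (S : set R) (s : seq R) (r : R) :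
  0 <= r -> measurable S ->
  (forall x, S x -> exists2 c, c \in s & `|x - c| <= r) ->
  (lebesgue_measure S <= (2 * r * (size s)%:R)%:E)%E.
Proof.
move=> r0; elim: s S => [|c s IH] S mS cov.
  rewrite mulr0 (_ : S = set0) ?measure0// -subset0 => x /cov[] //.
pose I := `[c - r, c + r]%classic.
have mI : measurable I by exact: measurable_itv.
rewrite (measureDI lebesgue_measure mS mI) /= -[(size s).+1%:R]natr1 mulrDr mulr1 EFinD.
apply: leeD.
  apply: IH; first exact: measurableD.
  move=> x [Sx Ix]; have [c'] := cov x Sx; rewrite inE => /predU1P[->|]; last first.
    by exists c'.
  rewrite ler_norml => /andP[h1 h2]; exfalso; apply: Ix.
  by rewrite /I/= in_itv/=; apply/andP; split; lra.
apply: (@le_trans _ _ (lebesgue_measure I)).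
  by apply: le_measure; rewrite ?inE//; exact: measurableI.
rewrite /I lebesgue_measure_itv/= lte_fin; case: ifPn => _.
  by rewrite -EFinB lee_fin; lra.
by rewrite lee_fin; lra.
Qed.

Section parametric_gap.
Context (R : realType) (T : finType) (C : {set T}) (p q : T -> R) (eta delta : R).
Hypotheses (eta_ge0 : 0 <= eta) (delta_gt0 : 0 < delta).
Hypothesis C_neq0 : exists E, E \in C.
Hypothesis sep : forall E E', E \in C -> E' \in C -> E != E' ->
  delta <= `|p E - p E'|.

Let val t E := q E + t * p E.
(* [up] tells whether the slope of the competitor exceeds that of [E]. *)
Let bad (up : bool) E : set R := [set t |
  (forall E', E' \in C -> val t E' <= val t E) /\
  exists E', [/\ E' \in C, E' != E, (p E < p E') = up & val t E < val t E' + eta]].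

(** At [t] the competitor is within [eta] of [E]. Moving by d in the direction in which it gains, it
    gains at least [delta * d] on [E], yet [E] is still on top at [t']; so d is at most
    [eta / delta]. The sign encodes the direction. *)
Lemma bad_slope up E t t' : E \in C -> bad up E t -> bad up E t' ->
  (-1) ^+ (~~ up) * (t' - t) <= eta / delta.
Proof.
move=> CE [_ [E' [CE' EE' pE lt]]] [/(_ _ CE') top' _].
rewrite ler_pdivlMr//.
have := sep CE' CE EE'; move: lt top' pE; rewrite /val => lt top'.
case: up => [pE|/negbT]; rewrite ?expr0 ?expr1.
  rewrite gtr0_norm ?subr_gt0// => dp.
  have [tt'|t't] := leP t t'; last first.
    rewrite (le_trans _ eta_ge0)// mul1r mulr_le0_ge0 ?(ltW delta_gt0)//.
    by rewrite subr_le0 ltW.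
  have := ler_wpM2l (_ : 0 <= t' - t) dp; rewrite subr_ge0 => /(_ tt').
  by lra.
rewrite -leNgt => pE; rewrite ler0_norm ?subr_le0// => dp.
have [tt'|t't] := leP t' t; last first.
  rewrite (le_trans _ eta_ge0)// mulN1r mulr_le0_ge0 ?(ltW delta_gt0)//.
  by rewrite oppr_le0 subr_ge0 ltW.
have := ler_wpM2l (_ : 0 <= t - t') dp; rewrite subr_ge0 => /(_ tt').
by lra.
Qed.

Lemma bad_near up E t t' : E \in C -> bad up E t -> bad up E t' ->
  `|t - t'| <= eta / delta.
Proof.
move=> CE bt bt'; have := bad_slope CE bt bt'; have := bad_slope CE bt' bt.
rewrite ler_norml; case: up {bt bt'}; rewrite ?expr0 ?expr1 => h1 h2;
  by apply/andP; split; lra.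
Qed.

Lemma small_gap_cover : exists s : seq R, size s = (2 * #|C|)%N /\
  forall t, ~ (exists2 E, E \in C & forall E', E' \in C -> E' != E ->
    val t E' + eta <= val t E) ->
  exists2 c, c \in s & `|t - c| <= eta / delta.
Proof.
(* One centre per cycle and direction: some bad parameter if there is one, the default value 0
   otherwise. *)
exists ([seq xget 0 (bad true E) | E <- enum C] ++
  [seq xget 0 (bad false E) | E <- enum C]).
split; first by rewrite size_cat !size_map -cardE mul2n addnn.
move=> t ngap; have [E0 CE0] := C_neq0.
case: (@Order.TotalTheory.arg_maxP _ _ _ E0 (mem C) (val t) CE0) => E CE Emax.
have [E' [CE' EE' lt]] : exists E', [/\ E' \in C, E' != E & val t E < val t E' + eta].
  apply: contrapT => nE; apply: ngap; exists E => // E' CE' EE'.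
  by rewrite leNgt; apply/negP => lt; apply: nE; exists E'.
have bt : bad (p E < p E') E t by split => //; exists E'.
have bx : bad (p E < p E') E (xget 0 (bad (p E < p E') E)).
  exact: (xgetPex 0 (ex_intro _ t bt)).
exists (xget 0 (bad (p E < p E') E)); last exact: bad_near bt bx.
rewrite mem_cat; apply/orP; case: (p E < p E'); [left|right];
  by apply/mapP; exists E; rewrite ?mem_enum.
Qed.

End parametric_gap.

(** * Construction of the probe *)

Section extension.
Context (n : nat).

(* The word [w.1] followed by [w.2] for ever. *)
Definition extension (w : n.-tuple bool * bool) : cantor_space :=
  fun i => nth w.2 w.1 i.

Lemma edge_extension w : edge n (extension w) = w.
Proof.
case: w => u c; congr (_, _); last by rewrite /extension/= nth_default// size_tuple.
by apply: eq_from_tnth => i; rewrite tnth_mktuple /extension/= (tnth_nth c).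
Qed.

Lemma extension_edge x i : (i <= n)%N -> extension (edge n x) i = x i.
Proof.
rewrite leq_eqVlt => /predU1P[->|lt_in]; last exact: nth_window.
by rewrite /extension nth_default// size_tuple.
Qed.

End extension.

Section probe.
Context (R : realType) (a : null_seq R).

(** The factor [2 ^- n] bounds the levels from m on by [2 * a m] in total, for any null sequence. *)
Definition amplitude n : R := a n / 2 ^+ n.

Lemma amplitude_gt0 n : 0 < amplitude n.
Proof. by rewrite divr_gt0 ?exprn_gt0// null_seq_gt0. Qed.

(** The bound of [exists_separating] at scale [amplitude n], a cycle having at most [2 ^ n]
    edges. *)
Definition separation n : R :=
  amplitude n / (2 *
    (#|cycles (@word_step n)| * #|cycles (@word_step n)|).+1%:R * (2 ^ n)%:R).

Lemma exists_weights n (P : cantor_space -> R) :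
  exists omega : n.-tuple bool * bool -> R,
  (forall w, 0 <= omega w <= amplitude n) /\
  forall E E', E \in cycles (@word_step n) -> E' \in cycles (@word_step n) -> E != E' ->
    separation n <= `|mean E (fun w => P (extension w) + omega w)
                      - mean E' (fun w => P (extension w) + omega w)|.
Proof.
apply: exists_separating; last exact: amplitude_gt0.
move=> E CE; rewrite (card_cycle_gt0 CE)/= (leq_trans (card_cycle_le CE))//.
by rewrite card_tuple card_bool.
Qed.

Definition weights n P := projT1 (cid (exists_weights n P)).
Arguments weights : clear implicits.

(** The weights of level [m] are chosen with the previous levels as background, so that the means of
    the total are separated; later levels count as error. *)
Fixpoint partial_probe n : cantor_space -> R :=
  if n is m.+1 then
    fun x => partial_probe m x + weights m (partial_probe m) (edge m x)
  else fun=> 0.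

(** The partial sums increase, so the supremum is the sum of the series. *)
Definition probe_fun x : R := sup (range (fun n => partial_probe n x)).

Lemma weights_itv n P w : 0 <= weights n P w <= amplitude n.
Proof. by rewrite /weights; case: cid => omega [/= h _]; exact: h. Qed.

Lemma partial_probe_separation n E E' :
  E \in cycles (@word_step n) -> E' \in cycles (@word_step n) -> E != E' ->
  separation n <= `|mean E (fun w => partial_probe n.+1 (extension w))
                    - mean E' (fun w => partial_probe n.+1 (extension w))|.
Proof.
move=> CE CE' EE'.
have -> : (fun w : n.-tuple bool * bool => partial_probe n.+1 (extension w)) =
    (fun w => partial_probe n (extension w) + weights n (partial_probe n) w).
  by apply/funext => w /=; rewrite edge_extension.
by rewrite /weights; case: cid => omega [/= _ h]; exact: h.
Qed.

Lemma partial_probe_agree n x y : (forall i, (i < n)%N -> x i = y i) ->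
  partial_probe n x = partial_probe n y.
Proof.
elim: n => //= n IH xy; rewrite IH => [|i /ltnW/xy//].
congr (_ + weights _ _ _); congr (_, _); last exact: xy.
by apply: eq_from_tnth => i; rewrite !tnth_mktuple; apply/xy/leqW.
Qed.

(** The amplitude at level m + i is at most [a m / 2 ^+ i]; the upper bound is the geometric sum
    over i < j. *)
Lemma partial_probe_tail m j x :
  0 <= partial_probe (m + j) x - partial_probe m x <= a m * (2 - 2 / 2 ^+ j).
Proof.
elim: j => [|j IH]; first by rewrite addn0 subrr divr1 subrr mulr0 lexx.
rewrite addnS /=; have := weights_itv (partial_probe (m + j)) (edge (m + j) x).
set w := weights _ _ _ => /andP[w0 wa].
have aj : amplitude (m + j) <= a m / 2 ^+ j.
  rewrite /amplitude; apply: ler_pM => //.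
  - exact/ltW/null_seq_gt0.
  - by rewrite (null_seq_decreasing a)// leq_addr.
  by rewrite lef_pV2 ?posrE ?exprn_gt0// ler_eXn2l ?ltr1n// leq_addl.
case/andP: IH => h1 h2; apply/andP; split; first lra.
have -> : a m * (2 - 2 / 2 ^+ j.+1) = a m * (2 - 2 / 2 ^+ j) + a m / 2 ^+ j.
  by rewrite exprS; field; rewrite expf_neq0.
by lra.
Qed.

Lemma partial_probe_le m n x : partial_probe n x <= partial_probe m x + 2 * a m.
Proof.
have am := null_seq_gt0 a m.
have [mn|/ltnW nm] := leqP m n.
  have := partial_probe_tail m (n - m) x; rewrite subnKC// => /andP[_].
  have : 0 <= a m * (2 / 2 ^+ (n - m)).
    by rewrite mulr_ge0 ?(ltW am)// divr_ge0// exprn_ge0.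
  lra.
have := partial_probe_tail n (m - n) x; rewrite subnKC// => /andP[].
lra.
Qed.

Lemma probe_fun_itv m x :
  partial_probe m x <= probe_fun x <= partial_probe m x + 2 * a m.
Proof.
apply/andP; split.
  apply: ub_le_sup; last by exists m.
  by exists (partial_probe m x + 2 * a m) => _ [n _ <-]; exact: partial_probe_le.
apply: ge_sup; first by exists (partial_probe m x), m.
by move=> _ [n _ <-]; exact: partial_probe_le.
Qed.

(** If the points first differ at [m], [partial_probe m] takes the same value at both, and the rest
    lies between 0 and [2 * a m]. *)
Lemma lip_probe_fun : lip_const a probe_fun 2.
Proof.
move=> x y; rewrite /seq_dist; case: pselect => [h|nh].
  case: ex_minnP => m _ mmin.
  have := probe_fun_itv m x; have := probe_fun_itv m y.
  rewrite (@partial_probe_agree m x y); last first.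
    by move=> i im; apply/eqP; apply: contraT => /mmin; rewrite leqNgt im.
  by rewrite ler_norml => /andP[? ?] /andP[? ?]; apply/andP; split; lra.
rewrite (_ : x = y) ?subrr ?normr0 ?mulr0//; apply/funext => i.
by apply/eqP; apply: contrapT => /negP xyi; apply: nh; exists i.
Qed.

Lemma probe_is_lip : probe_fun \in is_lip a.
Proof. by apply/asboolP; exists 2; exact: lip_probe_fun. Qed.

Definition probe : lipfun a := LipFun probe_is_lip.

End probe.

(** * Prevalence *)

Section locking_set.
Context (R : realType) (a : null_seq R).

Lemma lip_const_near (f g : lipfun a) L : lip_const a f L ->
  lip_const a g (L + `|g - f|).
Proof.
move=> fL.
have gfL : lip_const a (g - f) `|g - f|.
  apply: lip_constS (lip_const_lip (g - f)).
  by rewrite lipfun_normE lerDr (le_trans _ (ler_sup_norm _ point)).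
have -> : (g : cantor_space -> R) = (f : cantor_space -> R) + (g - f : lipfun a).
  by apply/funext => x; rewrite !fctE /= addrC subrK.
exact: lip_constD.
Qed.

Lemma lipfun_eval_near (f g : lipfun a) x : `|g x - f x| <= `|g - f|.
Proof.
apply: le_trans (ler_sup_norm (g - f) x) _.
by rewrite lipfun_normE lerDl (lip_const_ge0 (lip_const_lip (g - f))).
Qed.

(** For [g] at distance r from [f] the criterion applies with [e + r] and [L + r], for the same [F],
    cycle and gap; the strict inequality leaves room for small r. *)
Lemma locking_of_gap n (f : lipfun a) (F : n.-tuple bool * bool -> R) (L e eta : R) E :
  (0 < n)%N -> lip_const a f L -> (forall x, `|f x - F (edge n x)| <= e) ->
  3 * e + 2 * L * a n.+1 < eta ->
  (forall k, (n.+1 <= k)%N -> a k.+1 <= a k / 2) ->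
  E \in cycles (@word_step n) ->
  (forall E', E' \in cycles (@word_step n) -> E' != E ->
    mean E' F + eta <= mean E F) ->
  locking a f.
Proof.
move=> n0 fL fF eta_gt ha /imsetP[[b v]]; rewrite inE/= => vv -> gap.
have cmax (g : lipfun a) M r :
    lip_const a g M -> (forall x, `|g x - F (edge n x)| <= r) ->
    3 * r + 2 * M * a n.+1 < eta -> unique_maximizing (cycle_measure R b v) g.
  by move=> gM gF lt; exact: (cycle_measure_unique_maximizing n0 vv gM gF lt gap ha).
exists (cycle_measure R b v); split.
- exact: (cmax f L e).
- exact: cycle_measure_periodic.
(* A perturbation of size [rho] uses up half of the slack in the strict inequality. *)
pose rho := (eta - 3 * e - 2 * L * a n.+1) / (2 * (3 + 2 * a n.+1)).
have an := null_seq_gt0 a n.+1.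
have rho0 : 0 < rho by apply: divr_gt0; [move: eta_gt; lra|move: an; lra].
have rhoE : 3 * rho + 2 * rho * a n.+1 = (eta - 3 * e - 2 * L * a n.+1) / 2.
  by rewrite /rho; field; rewrite gt_eqF// -[_ + _]/(3 + 2 * a n.+1); move: an; lra.
have := nbhsx_ballx f rho rho0; apply: filterS => g.
rewrite -ball_normE/= distrC => gf.
apply: (cmax g (L + `|g - f|) (e + `|g - f|)); first exact: lip_const_near.
  move=> x; rewrite -(subrK (f x) (g x)) -addrA (le_trans (ler_normD _ _))//.
  by rewrite [leRHS]addrC lerD//; exact: lipfun_eval_near.
have : 3 * `|g - f| + 2 * `|g - f| * a n.+1 < 3 * rho + 2 * rho * a n.+1.
  by rewrite ltrD// ?ltr_pM2l// ltr_pM2r// ltr_pM2l.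
rewrite rhoE; move: eta_gt; lra.
Qed.

(** The measure that locks [f] also locks all nearby functions. Openness makes the locking set
    Borel. *)
Lemma open_locking : open (locking a).
Proof.
rewrite openE => f [mu [umu pmu nmu]].
rewrite /interior; have := near_join nmu; apply: filterS => g ng.
by exists mu; split => //; exact: (nbhs_singleton ng).
Qed.

End locking_set.

(** * Consequences of evanescence *)

Section evanescent.
Context (R : realType) (a : null_seq R).
Hypothesis a_ev : evanescent a.

(** Evanescence in terms of [2 ^ (2 ^ n)], the number of policies, which governs the number of
    cycles. *)
Lemma evanescent_bound : exists2 K : R, 0 < K &
  \forall n \near \oo, a n.+1 <= K * a n / (2 ^+ (2 ^ n)) ^+ 4.
Proof.
have /eqO_exP[K K0 nK] := a_ev; exists K => //.
apply: filterS nK => n /=.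
have h1 : 0 <= a n.+1 / a n by rewrite divr_ge0// ltW// null_seq_gt0.
have h2 : 0 <= 2 ^- (2 ^ n.+2) :> R by rewrite invr_ge0 exprn_ge0.
rewrite (ger0_norm h1) (ger0_norm h2).
rewrite ler_pdivrMr ?null_seq_gt0// mulrAC -exprM.
by rewrite (_ : 2 ^ n * 4 = 2 ^ n.+2)%N// !expnS; lia.
Qed.

(** This yields [(2 ^ n) ^ 6 <= 2 ^ (2 ^ n)] in the count of bad parameters. *)
Lemma exp_ge6n n : (5 <= n)%N -> (6 * n <= 2 ^ n)%N.
Proof.
elim: n => // n IH; rewrite leq_eqVlt => /predU1P[<-//|]; rewrite ltnS => n5.
by have := IH n5; rewrite expnS; lia.
Qed.

Lemma evanescent_halving : \forall n \near \oo, a n.+1 <= a n / 2.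
Proof.
have [K K0 nK] := evanescent_bound.
have K2 : \forall n \near \oo, K * 2 <= n%:R :> R.
  exists (Num.truncn (K * 2)).+1 => // n /= kn.
  by rewrite ltW// (lt_le_trans (truncnS_gt _))// ler_nat.
near=> n; have n0 : (0 < n)%N by near: n; exists 1%N.
have Kn : K * 2 <= n%:R by near: n.
have : a n.+1 <= K * a n / (2 ^+ (2 ^ n)) ^+ 4 by near: n.
move=> /le_trans; apply; rewrite mulrAC mulrC ler_wpM2l ?(ltW (null_seq_gt0 a n))//.
rewrite ler_pdivrMr ?exprn_gt0// ler_pdivlMl// mulrC (le_trans Kn)//.
rewrite -exprM -natrX ler_nat (leq_trans (ltnW (ltn_expl n (ltnSn 1))))//.
rewrite leq_exp2l// (leq_trans (ltnW (ltn_expl n (ltnSn 1))))// leq_pmulr//.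
Unshelve. all: by end_near. Qed.

End evanescent.

Section unit_interval_law.
Context (R : realType).

Let mI : measurable (`[0, 1]%classic : set (measurableTypeR R)) :=
  measurable_itv `[0, 1].

(** The Dirac measure is the default of [mnormalize] for a total mass of 0 or infinity; the mass
    here is 1. *)
Definition unit_law : probability (measurableTypeR R) R :=
  mnormalize (mrestr lebesgue_measure mI) (@dirac _ (measurableTypeR R) 0 R).

Lemma unit_lawE (A : set R) : unit_law A = lebesgue_measure (A `&` `[0, 1]).
Proof.
rewrite /unit_law/= /mnormalize/= /mrestr setTI.
have -> : lebesgue_measure (`[0, 1]%classic : set R) = 1%E.
  by rewrite lebesgue_measure_itv/= lte_fin ltr01 oppr0 adde0.
rewrite eqe oner_eq0/=. by rewrite invr1 mule1.
Qed.

End unit_interval_law.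

(** * Measure of the bad parameters on a line *)

Section probing.
Context (R : realType) (a : null_seq R).
Hypothesis a_ev : evanescent a.

(** The left side is the total length of the intervals of [small_gap_cover], with
    [eta = 6 * L * a n.+1]. Up to constants, for [Z = 2 ^ (2 ^ n)] and [P = 2 ^ n], the cycles
    contribute [(Z * P) ^ 3], the separation another [P ^ 2] and evanescence [Z ^- 4]; what remains
    is [P ^ 5 / Z <= 1 / P]. *)
Lemma gap_ratio_bound L : 0 <= L -> exists2 c : R, 0 <= c &
  \forall n \near \oo,
    2 * (6 * L * a n.+1 / separation a n) * (2 * #|cycles (@word_step n)|)%N%:R
      <= c / 2 ^+ n.
Proof.
move=> L0; have [K K0 nK] := evanescent_bound a_ev.
exists (96 * L * K); first by rewrite !mulr_ge0// ltW.
near=> n.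
have n5 : (5 <= n)%N by near: n; exists 5%N.
have aK : a n.+1 <= K * a n / (2 ^+ (2 ^ n)) ^+ 4 by near: n.
pose Z : R := 2 ^+ (2 ^ n); pose P : R := 2 ^+ n.
pose N : R := #|cycles (@word_step n)|%:R.
have P0 : 0 < P by rewrite exprn_gt0.
have Z0 : 0 < Z by rewrite exprn_gt0.
have a0 := null_seq_gt0 a n.
have N0 : 0 <= N by rewrite ler0n.
have NZP : N <= Z * P.
  have := card_cycles (@word_step n); rewrite card_tuple card_bool => h.
  by rewrite /N /Z /P -!natrX -natrM ler_nat.
have ZP : P ^+ 6 <= Z.
  by rewrite /P /Z -exprM ler_eXn2l ?ltr1n// mulnC exp_ge6n.
have P1 : 1 <= P by rewrite exprn_ege1// ler1n.
have Z1 : 1 <= Z by rewrite exprn_ege1// ler1n.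
have N3 : N * (N * N + 1) <= 2 * (Z * P) ^+ 3.
  have ZP1 : 1 <= Z * P by rewrite -[1]mulr1 ler_pM.
  have h2 : N * N <= (Z * P) * (Z * P) by exact: ler_pM.
  have h3 : N * N + 1 <= 2 * ((Z * P) * (Z * P)).
    have : 1 <= (Z * P) * (Z * P) by rewrite -[1]mulr1 ler_pM.
    lra.
  rewrite exprS expr2 mulrCA; apply: ler_pM => //.
  by rewrite addr_ge0// mulr_ge0.
have -> : 2 * (6 * L * a n.+1 / separation a n) * (2 * #|cycles (@word_step n)|)%N%:R
    = 48 * L * (N * (N * N + 1)) * P ^+ 2 * (a n.+1 / a n).
  have -> : separation a n = a n / P / (2 * (N * N + 1) * P).
    rewrite /separation /amplitude -/P natrX -/P; congr (_ / (_ * _ * _)).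
    by rewrite -natrM natr1.
  rewrite natrM -/N.
  have NN : N * N + 1 != 0 by rewrite gt_eqF// ltr_wpDl// mulr_ge0.
  by field; rewrite NN !gt_eqF.
apply: (@le_trans _ _ (48 * L * (2 * (Z * P) ^+ 3) * P ^+ 2 * (K / Z ^+ 4))).
  apply: ler_pM.
  - by rewrite !mulr_ge0 ?exprn_ge0 ?addr_ge0 ?(ltW P0)// mulr_ge0.
  - by rewrite divr_ge0 ?ltW ?null_seq_gt0.
  - by rewrite ler_wpM2r ?exprn_ge0 ?(ltW P0)// ler_wpM2l// mulr_ge0.
  - by rewrite ler_pdivrMr// mulrAC.
have -> : 48 * L * (2 * (Z * P) ^+ 3) * P ^+ 2 * (K / Z ^+ 4) =
    96 * L * K * (P ^+ 5 / Z).
  by field; rewrite gt_eqF.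
rewrite ler_wpM2l ?mulr_ge0 ?(ltW K0)// ler_pdivrMr// mulrC.
by rewrite ler_pdivlMr// -exprSr.
Unshelve. all: by end_near. Qed.

Lemma locking_line_small (v : lipfun a) : exists2 c : R, 0 <= c &
  \forall n \near \oo, forall S : set R, measurable S ->
    (forall t, S t -> t \in `[0, 1] /\ ~ locking a (t *: probe a - v)) ->
    (lebesgue_measure S <= (c / 2 ^+ n)%:E)%E.
Proof.
have [Lv vL] := lipfun_lip_const v; have Lv0 := lip_const_ge0 vL.
(* For [t] in [0, 1], [2 + Lv] is a Lipschitz constant of [t *: probe a - v] and bounds, in units of
   [a n.+1], the error of its truncation to n + 1 letters. *)
pose L := 3 + Lv; have L0 : 0 <= L by rewrite addr_ge0.
have [c c0 nc] := gap_ratio_bound L0; exists c => //.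
have [m _ mhalf] := evanescent_halving a_ev.
near=> n => S mS Sbad.
have n_gt0 : (0 < n)%N by near: n; exists 1%N.
have mn : (m <= n)%N by near: n; exists m.
have ha k : (n.+1 <= k)%N -> a k.+1 <= a k / 2.
  by move=> nk; apply: mhalf; rewrite /= (leq_trans mn)// ltnW.
have an := null_seq_gt0 a n.+1.
pose C := cycles (@word_step n).
pose p E := mean E (fun w : n.-tuple bool * bool => partial_probe a n.+1 (extension w)).
pose q E := mean E (fun w : n.-tuple bool * bool => - v (extension w)).
have sep0 : 0 < separation a n.
  by rewrite divr_gt0 ?amplitude_gt0// !mulr_gt0// ltr0n expn_gt0.
(* With [e = L * a n.+1] the criterion asks for a gap larger than [5 * L * a n.+1]. *)
have eta0 : 0 <= 6 * L * a n.+1 by rewrite !mulr_ge0// ltW.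
have [s [ss scov]] := small_gap_cover (p := p) q eta0 sep0
  (cycles_neq0 (@word_step n) (nseq_tuple n true)) (@partial_probe_separation _ a n).
apply: (@le_trans _ _ (2 * (6 * L * a n.+1 / separation a n) * (size s)%:R)%:E).
  apply: lebesgue_measure_cover => //; first by rewrite divr_ge0// ltW.
  move=> t /Sbad[t01 nlock]; apply: scov => -[E CE gap]; apply: nlock.
  have t1 : `|t| <= 1 by move: t01; rewrite in_itv/= => /andP[? ?]; rewrite ger0_norm.
  pose F (w : n.-tuple bool * bool) :=
    t * partial_probe a n.+1 (extension w) - v (extension w).
  have fE x : (t *: probe a - v : lipfun a) x = t * probe_fun a x - v x by [].
  have FE E' : mean E' F = q E' + t * p E'.
    by rewrite /F meanD meanZ addrC.
  apply: (@locking_of_gap _ _ n _ F L (L * a n.+1) (6 * L * a n.+1) E) => //.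
  - apply: (@lip_constS _ _ _ (`|t| * 2 + Lv)).
      by rewrite /L; have := t1; lra.
    apply: lip_constD; first exact: lip_constZ (lip_probe_fun a).
    by have := lip_constZ (-1) vL; rewrite normrN1 mul1r scaleN1r.
  - move=> x; rewrite fE /F.
    have ex i : (i < n.+1)%N -> extension (edge n x) i = x i.
      by rewrite ltnS; exact: extension_edge.
    rewrite (partial_probe_agree a ex).
    have h1 : `|probe_fun a x - partial_probe a n.+1 x| <= 2 * a n.+1.
      have := probe_fun_itv a n.+1 x => /andP[? ?].
      by rewrite ger0_norm; lra.
    have h2 : `|v x - v (extension (edge n x))| <= Lv * a n.+1.
      apply: le_trans (vL _ _) _; rewrite ler_wpM2l//.
      by apply: seq_dist_agree => i /ex.
    have -> : t * probe_fun a x - v x -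
        (t * partial_probe a n.+1 x - v (extension (edge n x))) =
        t * (probe_fun a x - partial_probe a n.+1 x) -
        (v x - v (extension (edge n x))) by ring.
    rewrite (le_trans (ler_normB _ _))// normrM.
    have h3 : `|t| * `|probe_fun a x - partial_probe a n.+1 x| <= 1 * (2 * a n.+1).
      exact: ler_pM.
    have : 0 <= a n.+1 by exact: ltW.
    by rewrite /L; move: h2 h3; lra.
  - have : 0 < L * a n.+1 by rewrite mulr_gt0// /L; move: Lv0; lra.
    lra.
  - by move=> E' CE' EE'; rewrite !FE; exact: gap.
rewrite lee_fin ss; near: n; exact: nc.
Unshelve. all: by end_near. Qed.

End probing.

Theorem theorem1 (R : realType) (a : null_seq R) :
  evanescent a -> prevalent (locking a).
Proof.
move=> a_ev; exists (~` locking a); split=> //; split.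
  by apply: measurableC; apply: sub_sigma_algebra; exact: open_locking.
have line_cont (v : lipfun a) : continuous (fun t : R => t *: probe a - v).
  by move=> t; apply: cvgB; [exact: scalel_continuous|exact: cvg_cst].
have mline : measurable_fun [set: measurableTypeR R]
    (fun t : measurableTypeR R => (t *: probe a : borel (lipfun a))).
  apply: (measurability _
    (erefl : @measurable _ (borel (lipfun a)) = <<s @open (lipfun a) >>)).
  move=> _ [U oU <-]; rewrite setTI; apply: open_measurable.
  by move/continuousP: (@scalel_continuous _ _ (probe a)); exact.
pose line : {mfun measurableTypeR R >-> borel (lipfun a)} :=
  mfun_Sub (mem_set mline).
(* The law of [t *: probe a] for uniform [t], carried by a compact segment. *)
exists (distribution (unit_law R) line), [set t *: probe a | t in `[0, 1]%classic]; split.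
- apply: continuous_compact; last exact: segment_compact.
  by apply: continuous_subspaceT; exact: scalel_continuous.
- rewrite -[LHS]/(unit_law R (line @^-1` _)) unit_lawE.
  rewrite (_ : _ `&` _ = set0) ?measure0// -subset0 => t [/= nt t01].
  by apply: nt; exists t.
move=> v; rewrite -[LHS]/(unit_law R (line @^-1` _)) unit_lawE.
pose S : set R := (fun t : R => t *: probe a - v) @^-1` (~` locking a) `&` `[0, 1].
(* [t *: probe a] lies in the translate by [v] exactly when [t *: probe a - v] fails to lock. *)
rewrite (_ : _ `&` _ = S); last first.
  congr (_ `&` _); apply/seteqP; split=> t /=.
    by move=> [s ns /(congr1 (fun w => w - v))]; rewrite addrK => <-.
  by move=> nt; exists (t *: probe a - v) => //; rewrite subrK.
have mS : measurable S.
  apply: measurableI; last exact: measurable_itv.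
  have oG : open ((fun t : R => t *: probe a - v) @^-1` locking a).
    by have /continuousP cv := line_cont v; apply: cv; exact: open_locking.
  rewrite preimage_setC; apply: measurableC; exact: open_measurable.
have [c c0 Sc] := locking_line_small a_ev v.
(* The bounds [c / 2 ^+ n], valid for all large n, force measure zero. *)
apply/eqP; rewrite eq_le measure_ge0 andbT; apply/lee_addgt0Pr => e e0.
rewrite add0e.
have ce : \forall n \near \oo, c / e <= n%:R.
  exists (Num.truncn (c / e)).+1 => // n /= kn.
  by rewrite ltW// (lt_le_trans (truncnS_gt _))// ler_nat.
near \oo => n.
have /(_ S mS) Sn : forall S : set R, measurable S ->
    (forall t, S t -> t \in `[0, 1] /\ ~ locking a (t *: probe a - v)) ->
    (lebesgue_measure S <= (c / 2 ^+ n)%:E)%E by near: n.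
apply: le_trans (Sn _) _ => [t [] //|].
rewrite lee_fin ler_pdivrMr ?exprn_gt0// mulrC -ler_pdivrMr//.
have : c / e <= n%:R by near: n.
by move=> /le_trans; apply; rewrite -natrX ler_nat ltnW// ltn_expl.
Unshelve. all: by end_near. Qed.
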